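(* Let $\varphi\in\Gamma_0(\mathcal{X})$, let $f\in\Gamma_0(\mathcal{X})$ be a Legendre function, let $x\in\operatorname{int\,dom}f$, let $u^*\in\mathcal{X}^*$, and let $\gamma\in\,]0,+\infty[$. Suppose that $(\operatorname{int\,dom}f)\cap\operatorname{dom}\partial\varphi\neq\varnothing$ and that one of the following holds: (i) $\gamma u^*+\operatorname{int\,dom}f^*\subset\operatorname{ran}(\nabla f+\gamma\partial\varphi)$. (ii) $(\operatorname{int\,dom}f^* )+\gamma\operatorname{dom}\partial\varphi^*=\mathcal{X}^*$. (iii) $f+\gamma\varphi$ is cofinite. (iv) $f+\gamma\varphi$ is supercoercive. (v) $\operatorname{dom}f\cap\operatorname{dom}\varphi$ is bounded. Then $\operatorname{prox}^{\nabla f}_{\gamma(\varphi-u^* )}x$ is a singleton and, setting $z=\operatorname{prox}^{\nabla f}_{\gamma(\varphi-u^* )}x$, $$L_\varphi(x,u^* )\geq\frac{D_f(x,z)+D_f(z,x)}{\gamma}.$$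
   Context: $\mathcal{X}\neq\{0\}$ is a reflexive real Banach space with topological dual $\mathcal{X}^*$, and $\langle\cdot,\cdot\rangle$ is the canonical duality pairing. $\Gamma_0(\mathcal{X})$ is the class of proper lower semicontinuous convex functions from $\mathcal{X}$ to $]-\infty,+\infty]$. For $\varphi\colon\mathcal{X}\to\,]-\infty,+\infty]$: $\operatorname{dom}\varphi=\{\varphi<+\infty\}$; the conjugate is $\varphi^*\colon x^*\mapsto\sup_{x}(\langle x,x^*\rangle-\varphi(x))$; the Fenchel--Young function is $L_\varphi\colon(x,u^* )\mapsto\varphi(x)+\varphi^*(u^* )-\langle x,u^*\rangle$; the subdifferential is $\partial\varphi\colon x\mapsto\{x^*\in\mathcal{X}^*\mid(\forall y\in\mathcal{X})\ \langle y-x,x^*\rangle+\varphi(x)\leq\varphi(y)\}$, with $\operatorname{dom}\partial\varphi=\{x\mid\partial\varphi(x)\neq\varnothing\}$. $\varphi$ is cofinite if $\operatorname{dom}\varphi^*=\mathcal{X}^*$ and supercoercive if $\lim_{\|x\|\to+\infty}\varphi(x)/\|x\|=+\infty$. $\varphi-u^*$ denotes the function $y\mapsto\varphi(y)-\langle y,u^*\rangle$. $f\in\Gamma_0(\mathcal{X})$ is a Legendre function if it is essentially smooth ($\partial f$ is both locally bounded and single-valued on its domain) and essentially strictly convex ($\partial f^*$ is locally bounded on its domain and $f$ is strictly convex on every convex subset of $\operatorname{dom}\partial f$). $\nabla f$ is viewed as an operator with domain $\operatorname{int\,dom}f$ (empty-valued elsewhere). For set-valued operators $A\colon\mathcal{X}\to2^{\mathcal{X}^*}$,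 $\operatorname{ran}A=\bigcup_xAx$, $A^{-1}x^*=\{x\mid x^*\in Ax\}$, and compositions are unions of images. The warped proximity operator of $\varphi$ with kernel $K\colon\mathcal{X}\to2^{\mathcal{X}^*}$ is $\operatorname{prox}_\varphi^K=(K+\partial\varphi)^{-1}\circ K$; a singleton value is identified with its element. The Bregman distance is $D_f(x,y)=f(x)-f(y)-\langle x-y,\nabla f(y)\rangle$ if $y\in\operatorname{int\,dom}f$, and $D_f(x,y)=+\infty$ otherwise. *)

(* Defs.v *)
From HB Require Import structures.
From mathcomp Require Import all_boot all_order all_algebra.
From mathcomp Require Import all_classical all_reals all_analysis.

Set Implicit Arguments.
Unset Strict Implicit.
Unset Printing Implicit Defensive.

Import Order.TTheory GRing.Theory Num.Theory.
Import numFieldNormedType.Exports.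

Local Open Scope classical_set_scope.
Local Open Scope ring_scope.

Section dual_type.
Context {R : realType} (X : normedModType R).

Definition dual_pred : {pred X -> R^o} :=
  mem [set u : X -> R^o | linear u /\ continuous u].

Record dual := Dual { dual_fun :> X -> R^o; _ : dual_fun \in dual_pred }.

HB.instance Definition _ := [isSub for dual_fun].
HB.instance Definition _ := [Choice of dual by <:].

Lemma dualP (u : dual) : linear u /\ continuous u.
Proof. by case: u => u /=; rewrite inE. Qed.

Fact dual_submod_closed : submod_closed dual_pred.
Proof.
split; first by rewrite inE; split; [move=> a x y; rewrite /= scaler0 addr0
                                    | exact: cst_continuous].
move=> a u v; rewrite !inE => -[ul uc] [vl vc]; split.
  move=> b x y; rewrite !fctE ul vl !scalerDr !scalerA (mulrC a b).
  by rewrite !addrA; congr (_ + _); rewrite -!addrA; congr (_ + _); rewrite addrC.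
move=> x; apply: cvgD; last exact: vc.
by apply: cvgZl_tmp; exact: uc.
Qed.

HB.instance Definition _ :=
  GRing.isSubmodClosed.Build R (X -> R^o) dual_pred dual_submod_closed.
HB.instance Definition _ := [SubChoice_isSubLmodule of dual by <:].

End dual_type.

Section dual_norm.
Context {R : realType} (X : normedModType R).
Implicit Types (u v : dual X) (x : X).

Lemma dual_linear u : linear u. Proof. by case: (dualP u). Qed.
Lemma dual_continuous u : continuous u. Proof. by case: (dualP u). Qed.

HB.instance Definition _ u := GRing.isLinear.Build R X R^o _ u (@dual_linear u).

Lemma dualD u v x : (u + v) x = u x + v x. Proof. by []. Qed.
Lemma dualZ (a : R) u x : (a *: u) x = a * u x. Proof. by []. Qed.
Lemma dualN u x : (- u) x = - u x. Proof. by []. Qed.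
Lemma dual0 x : (0 : dual X) x = 0. Proof. by []. Qed.

Definition dual_norm u : R := sup [set `|u x| | x in [set x : X | `|x| <= 1]].

Lemma dual_norm_has_sup u : has_sup [set `|u x| | x in [set x : X | `|x| <= 1]].
Proof.
split; first by exists `|u 0|; exists 0 => //=; rewrite normr0.
have /linear_boundedP/pinfty_ex_gt0 [M M0 Mu] : bounded_near u (nbhs (0 : X)).
  by apply/linear_bounded_continuous; exact: dual_continuous.
exists M => _ [x /= x1 <-]; apply: le_trans (Mu x) _.
by rewrite -[leRHS]mulr1 ler_wpM2l// ltW.
Qed.

Lemma dual_norm_ge0 u : 0 <= dual_norm u.
Proof.
apply: (@le_trans _ _ `|u 0|) => //; apply: sup_upper_bound.
  exact: dual_norm_has_sup.
by exists 0 => //=; rewrite normr0.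
Qed.

Lemma dual_norm_le u x : `|u x| <= dual_norm u * `|x|.
Proof.
have [->|x0] := eqVneq x 0; first by rewrite linear0 !normr0 mulr0.
have nx0 : 0 < `|x| by rewrite normr_gt0.
rewrite -ler_pdivrMr//.
have -> : `|u x| / `|x| = `|u (`|x|^-1 *: x)|.
  by rewrite linearZ/= normrM (ger0_norm (x := `|x|^-1))// mulrC.
apply: sup_upper_bound; first exact: dual_norm_has_sup.
by exists (`|x|^-1 *: x) => //=; rewrite normrZ normfV normr_id mulVf// gt_eqF.
Qed.

Lemma dual_norm_lub u M :
  (forall x, `|x| <= 1 -> `|u x| <= M) -> dual_norm u <= M.
Proof.
move=> uM; apply: ge_sup; first by case: (dual_norm_has_sup u).
by move=> _ [x /= x1 <-]; exact: uM.
Qed.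

Fact dual_normD u v : dual_norm (u + v) <= dual_norm u + dual_norm v.
Proof.
apply: dual_norm_lub => x x1; apply: le_trans (ler_normD _ _) _.
by apply: lerD; apply: le_trans (dual_norm_le _ _) _;
   rewrite -[leRHS]mulr1 ler_wpM2l// dual_norm_ge0.
Qed.

Fact dual_normZ (a : R) u : dual_norm (a *: u) = `|a| * dual_norm u.
Proof.
have le_normZ (b : R) v : dual_norm (b *: v) <= `|b| * dual_norm v.
  apply: dual_norm_lub => x x1; rewrite dualZ normrM ler_wpM2l//.
  by apply: le_trans (dual_norm_le _ _) _;
     rewrite -[leRHS]mulr1 ler_wpM2l// dual_norm_ge0.
apply/eqP; rewrite eq_le le_normZ/=.
have [->|a0] := eqVneq a 0; first by rewrite normr0 mul0r dual_norm_ge0.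
rewrite -ler_pdivlMl ?normr_gt0// -normfV.
by rewrite -[X in dual_norm X <= _](scalerK a0) le_normZ.
Qed.

Fact dual_norm0_eq0 u : dual_norm u = 0 -> u = 0.
Proof.
move=> u0; apply/val_inj/funext => x /=; apply/eqP; rewrite -normr_le0.
by have := dual_norm_le u x; rewrite u0 mul0r.
Qed.

HB.instance Definition _ := @Lmodule_isNormed.Build R (dual X) dual_norm
  dual_normD dual_normZ dual_norm0_eq0.

End dual_norm.

(** The canonical embedding into the bidual is onto. *)
Definition reflexive_space {R : realType} (X : normedModType R) : Prop :=
  forall Phi : dual (dual X), exists x : X, forall u : dual X, Phi u = u x.

Section set_valued.
Context {R : realType} {S T U : Type} {V : lmodType R}.

Definition dom_op (A : S -> set T) : set S := [set x | A x !=set0].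
Definition ran_op (A : S -> set T) : set T := \bigcup_(x in setT) A x.
Definition inv_op (A : S -> set T) : T -> set S := fun y => [set x | A x y].
Definition comp_op (B : T -> set U) (A : S -> set T) : S -> set U :=
  fun x => \bigcup_(y in A x) B y.
Definition add_set (C D : set V) : set V := [set c + d | c in C & d in D].
Definition scale_set (a : R) (C : set V) : set V := [set a *: c | c in C].
Definition add_op (A B : S -> set V) : S -> set V :=
  fun x => add_set (A x) (B x).
Definition scale_op (a : R) (A : S -> set V) : S -> set V :=
  fun x => scale_set a (A x).

End set_valued.

Definition single_valued_on_dom {S T : Type} (A : S -> set T) : Prop :=
  forall x u v, A x u -> A x v -> u = v.

(** The neighbourhood [W] of a point of the domain is taken in the whole space,
    so [W] need not be contained in the domain. *)
Definition locally_bounded_on_dom {R : realType} {X Y : normedModType R}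
    (A : X -> set Y) : Prop :=
  forall x, dom_op A x ->
    exists2 W, nbhs x W & bounded_set (\bigcup_(y in W) A y).

Section convex_functions.
Context {R : realType} {X : normedModType R}.
Implicit Types (f : X -> \bar R) (x y : X) (u : dual X).

Local Open Scope ereal_scope.

Definition edom f : set X := [set x | f x < +oo].

Definition econvex f : Prop :=
  forall x y (t : R), (0 < t < 1)%R ->
    f (t *: x + (1 - t) *: y)%R <= t%:E * f x + (1 - t)%:E * f y.

Definition Gamma0 f : Prop :=
  [/\ forall x, -oo < f x, edom f !=set0, lower_semicontinuous f & econvex f].

Definition conjugate f : dual X -> \bar R :=
  fun u => ereal_sup [set (u x)%:E - f x | x in setT].

Definition fenchel_young f x u : \bar R := f x + conjugate f u - (u x)%:E.

Definition subdiff f : X -> set (dual X) :=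
  fun x => [set u | forall y, (u (y - x)%R)%:E + f x <= f y].

Definition supercoercive f : Prop :=
  forall M : R, exists N : R, forall x, (N < `|x|)%R ->
    M%:E < f x * (`|x|^-1)%:E.

Definition strictly_convex_on (C : set X) f : Prop :=
  forall x y (t : R), C x -> C y -> x <> y -> (0 < t < 1)%R ->
    f (t *: x + (1 - t) *: y)%R < t%:E * f x + (1 - t)%:E * f y.

End convex_functions.

Section legendre.
Context {R : realType} {X : normedModType R}.
Implicit Types (f g : X -> \bar R) (x y : X) (u : dual X).

Local Open Scope ereal_scope.

Definition cofinite f : Prop := edom (conjugate f) = setT.

Definition essentially_smooth f : Prop :=
  locally_bounded_on_dom (subdiff f) /\ single_valued_on_dom (subdiff f).

(** [subdiff (conjugate f)] takes its values in the bidual of [X], which is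
    isometric to [X] when [X] is reflexive. *)
Definition essentially_strictly_convex f : Prop :=
  locally_bounded_on_dom (subdiff (conjugate f)) /\
  forall C : set X, convex_set C -> C `<=` dom_op (subdiff f) ->
    strictly_convex_on C f.

Definition legendre f : Prop :=
  essentially_smooth f /\ essentially_strictly_convex f.

(** Gateaux gradient; [fine] loses nothing because a function of [Gamma0] is
    finite near every point of the interior of its domain. *)
Definition nabla f : X -> set (dual X) :=
  fun x => [set u | (edom f)° x /\
                    forall h : X, is_derive x h (fine \o f : X -> R^o) (u h)].

(** [xget 0 (nabla f y)] is the unique element of [nabla f y] if there is one. *)
Definition bregman f x y : \bar R :=
  if `[< (edom f)° y >]
  then f x - f y - ((xget 0%R (nabla f y)) (x - y)%R)%:E
  else +oo.

Definition warped_prox (K : X -> set (dual X)) g : X -> set X :=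
  comp_op (inv_op (add_op K (subdiff g))) K.

End legendre.

(* Main.v *)
Require Import Defs.
From HB Require Import structures.
From mathcomp Require Import all_boot all_order all_algebra.
From mathcomp Require Import all_classical all_reals all_analysis.
From mathcomp Require Import ring lra.

Import Order.TTheory GRing.Theory Num.Theory.
Import numFieldNormedType.Exports.

(** Write [k] for the gradient of [f] at [x]. A point [z] is a value of the
    warped proximity operator exactly when
    [k + gamma *: u = w + gamma *: b] for some [w] in [nabla f z] and [b] in
    [subdiff phi z]. Two such points coincide because the gradient of a
    Legendre function is strictly monotone while [subdiff phi] is monotone, and
    the inequality is the sum of the subgradient inequality of [phi] at [z] for
    [b] and of the Young inequality for [u] at [z]: the Bregman distances
    in both directions add up to [(k - w) (x - z)]. Existence is the real issue.

    Under (i) one only has to know that [k] lies in the interior of the domain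
    of [conjugate f]. Each of (ii) to (v) makes [h := f + gamma phi] cofinite.
    Then [conjugate h] is finite on the whole dual, hence bounded above near
    every point by Baire's theorem, hence subdifferentiable everywhere by
    Hahn-Banach; by reflexivity the subgradient at [k + gamma *: u] is a point
    [z] of [X], and since [h] is the supremum of its affine minorants,
    [k + gamma *: u] is a subgradient of [h] at [z]
    ([subdiff_surj_interior_conjugate]). The sum rule [subdiff_add] splits that
    subgradient, and its first part is the gradient of [f] because [f] is
    Legendre.

    Two facts carry the rest.
    - [convex_sandwich]: two convex relations lying one above the other are
      separated by a continuous affine function as soon as one of them contains
      a horizontal disc centred above a point of the other. Existence of
      subgradients, the sum rule, affine minorants and Gateaux
      differentiability are all instances of it.
    - [interior_of_locally_bounded_subdiff]: where its subdifferential is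
      nonempty and locally bounded, a closed convex function on a Banach space
      is finite on a neighbourhood. Applied to [f] it shows that the gradient
      and the subdifferential are the same operator; applied to [conjugate f]
      on the dual it settles (i). Its proof combines Ekeland's variational
      principle with the sum rule. *)

Set Implicit Arguments.
Unset Strict Implicit.
Unset Printing Implicit Defensive.

Local Open Scope classical_set_scope.
Local Open Scope ring_scope.

(** * The Hahn-Banach theorem for sublinear functions *)

Definition sublinear (R : realType) (X : lmodType R) (p : X -> R) : Prop :=
  (forall x y, p (x + y) <= p x + p y) /\
  (forall t x, 0 < t -> p (t *: x) = t * p x).

Lemma sublinear0 (R : realType) (X : lmodType R) (p : X -> R) :
  sublinear p -> p 0 = 0.
Proof.
move=> [_ /(_ 2 0)]; rewrite scaler0 => /(_ _)/wrap[]//.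
by lra.
Qed.

Lemma sublinear_geN (R : realType) (X : lmodType R) (p : X -> R) x :
  sublinear p -> - p (- x) <= p x.
Proof.
move=> sp; have := sp.1 x (- x); rewrite subrr (sublinear0 sp); lra.
Qed.

Lemma sublinear_chain_inf (R : realType) (X : lmodType R) (p : X -> R)
    (A : set (X -> R)) : A !=set0 ->
  (forall q, A q -> sublinear q /\ forall x, q x <= p x) ->
  (forall q r, A q -> A r -> (forall x, q x <= r x) \/ (forall x, r x <= q x)) ->
  exists2 m, sublinear m & forall q, A q -> forall x, m x <= q x.
Proof.
move=> [q0 Aq0] Ap tot.
pose S x := [set q x | q in A].
have Sinf x : has_inf (S x).
  split; first by exists (q0 x), q0.
  exists (- p (- x)) => _ [q Aq <-]; have [sq qp] := Ap q Aq.
  by apply: le_trans (sublinear_geN x sq); rewrite lerN2.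
have mle q x : A q -> inf (S x) <= q x.
  by move=> Aq; apply: ge_inf; [exact: (Sinf x).2|exists q].
exists (fun x => inf (S x)); last by move=> q Aq x; exact: mle.
split=> [x y|t x t0].
  suff h q r : A q -> A r -> inf (S (x + y)) <= q x + r y.
    rewrite -lerBlDr; apply: lb_le_inf; first exact: (Sinf x).1.
    move=> _ [q Aq <-]; rewrite lerBlDr -lerBlDl.
    apply: lb_le_inf; first exact: (Sinf y).1.
    by move=> _ [r Ar <-]; rewrite lerBlDl; exact: h.
  move=> Aq Ar; case: (tot _ _ Aq Ar) => le.
    apply: le_trans (mle q _ Aq) _; apply: le_trans ((Ap _ Aq).1.1 _ _) _.
    by rewrite lerD2l.
  apply: le_trans (mle r _ Ar) _; apply: le_trans ((Ap _ Ar).1.1 _ _) _.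
  by rewrite lerD2r.
apply/eqP; rewrite eq_le; apply/andP; split.
  rewrite -ler_pdivrMl//; apply: lb_le_inf; first exact: (Sinf x).1.
  move=> _ [q Aq <-]; rewrite ler_pdivrMl// -(Ap _ Aq).1.2//; exact: mle.
apply: lb_le_inf; first exact: (Sinf _).1.
by move=> _ [q Aq <-]; rewrite (Ap _ Aq).1.2// ler_pM2l//; exact: mle.
Qed.

(** Zorn's lemma on the sublinear functions below [p], ordered by decreasing
    values: the infimum of a chain stays finite because
    [- p (- x) <= - q (- x) <= q x] for every member [q]. *)
Lemma sublinear_minimal (R : realType) (X : lmodType R) (p : X -> R) :
  sublinear p -> exists q, [/\ sublinear q, forall x, q x <= p x &
    forall r, sublinear r -> (forall x, r x <= q x) -> r = q].
Proof.
move=> sp.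
pose T := {q : X -> R | sublinear q /\ forall x, q x <= p x}.
pose le (q r : T) := `[< forall x, sval r x <= sval q x >].
have [||||[q [sq qp]] qmin] := @Zorn T le.
- by move=> q; apply/asboolP.
- move=> q r s /asboolP qr /asboolP rs; apply/asboolP => x.
  exact: le_trans (rs x) (qr x).
- move=> [q Pq] [r Pr] /asboolP/= qr /asboolP/= rq; apply: eq_exist.
  by apply: funext => x; apply/eqP; rewrite eq_le qr rq.
- move=> A totA; have [->|/set0P [q0 Aq0]] := eqVneq A set0.
    by exists (exist _ p (conj sp (fun=> lexx _))).
  case: (@sublinear_chain_inf R X p [set sval q | q in A]) => [|||m sm mle].
  + by exists (sval q0), q0.
  + by move=> _ [q _ <-]; exact: (svalP q).
  + move=> _ _ [q Aq <-] [r Ar <-].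
    by case: (totA _ _ Aq Ar) => /asboolP ?; [right|left].
  + have mp x : m x <= p x.
      apply: le_trans ((svalP q0).2 x); apply: mle; by exists q0.
    exists (exist _ m (conj sm mp)) => s As; apply/asboolP => x /=.
    by apply: mle; exists s.
exists q; split=> // r sr rq.
have rp x : r x <= p x by exact: le_trans (rq x) (qp x).
have := qmin (exist _ r (conj sr rp)) => /(_ _)/wrap[]; first exact/asboolP.
by case.
Qed.

(** For fixed [y] the function [x |-> inf_{t >= 0} (q (x + t y) - t q y)] is
    sublinear and below [q], so by minimality it is [q]; the value of the
    infimand at [t = 1] is then the missing half of additivity. *)
Lemma sublinear_minimal_additive (R : realType) (X : lmodType R) (q : X -> R) :
  sublinear q ->
  (forall r, sublinear r -> (forall x, r x <= q x) -> r = q) ->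
  forall x y, q (x + y) = q x + q y.
Proof.
move=> sq qmin x y; apply/eqP; rewrite eq_le sq.1/=.
pose S x := [set q (x + t *: y) - t * q y | t in [set t | 0 <= t]].
have qZ t z : 0 <= t -> q (t *: z) = t * q z.
  rewrite le_eqVlt => /predU1P[<-|/sq.2//].
  by rewrite scale0r mul0r (sublinear0 sq).
have Sinf z : has_inf (S z).
  split; first by exists (q (z + 0 *: y) - 0 * q y), 0 => /=.
  exists (- q (- z)) => _ [t t0 <-].
  have := sq.1 (- z) (z + t *: y); rewrite addKr qZ//; lra.
have Sle z t : 0 <= t -> inf (S z) <= q (z + t *: y) - t * q y.
  by move=> t0; apply: ge_inf; [exact: (Sinf z).2|exists t].
have /(congr1 (@^~ x)) <- : (fun z => inf (S z)) = q.
  apply: qmin; last first.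
    by move=> z /=; have := Sle z 0 (lexx 0); rewrite scale0r addr0; lra.
  split=> [a b|t a t0].
    rewrite -lerBlDr; apply: lb_le_inf; first exact: (Sinf a).1.
    move=> _ [s /= s0 <-]; rewrite lerBlDr -lerBlDl.
    apply: lb_le_inf; first exact: (Sinf b).1.
    move=> _ [t /= t0 <-]; rewrite lerBlDl.
    apply: le_trans (Sle _ (s + t) _) _; first exact: addr_ge0.
    rewrite scalerDl addrACA; have := sq.1 (a + s *: y) (b + t *: y); lra.
  apply/eqP; rewrite eq_le; apply/andP; split.
    rewrite -ler_pdivrMl//; apply: lb_le_inf; first exact: (Sinf a).1.
    move=> _ [s /= s0 <-]; rewrite ler_pdivrMl//.
    apply: le_trans (Sle _ (t * s) _) _; first by rewrite mulr_ge0// ltW.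
    by rewrite -scalerA -scalerDr sq.2// mulrBr mulrA.
  apply: lb_le_inf; first exact: (Sinf _).1.
  move=> _ [s /= s0 <-]; rewrite -ler_pdivlMl//.
  apply: le_trans (Sle _ (t^-1 * s) _) _; first by rewrite mulr_ge0// invr_ge0 ltW.
  have -> : a + (t^-1 * s) *: y = t^-1 *: (t *: a + s *: y).
    by rewrite scalerDr !scalerA mulVf ?gt_eqF// scale1r.
  by rewrite sq.2 ?invr_gt0// -mulrA mulrBr.
have := Sle x 1 ler01; rewrite scale1r; lra.
Qed.

Lemma hahn_banach_sublinear (R : realType) (X : lmodType R) (p : X -> R) :
  sublinear p -> exists w : X -> R^o, linear w /\ forall x, w x <= p x.
Proof.
move=> /sublinear_minimal[q [sq qp qmin]]; exists q; split=> // a x y.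
have qD := sublinear_minimal_additive sq qmin.
rewrite qD; congr (_ + _).
have qN z : q (- z) = - q z.
  by have := qD z (- z); rewrite subrr (sublinear0 sq); lra.
have [a0|a0|->] := ltgtP a 0; last by rewrite !scale0r (sublinear0 sq).
  have := sq.2 (- a) x; rewrite oppr_gt0 => /(_ a0).
  by rewrite scaleNr qN mulNr => /oppr_inj.
exact: sq.2.
Qed.

(** Continuity of a linear form comes for free from a one-sided bound on a
    ball, because the ball is symmetric. *)
Lemma dual_of_bounded_above (R : realType) (X : normedModType R)
    (w : X -> R^o) (C e : R) : 0 < e -> linear w ->
  (forall x, `|x| < e -> w x <= C) -> exists v : dual X, forall x, v x = w x.
Proof.
move=> e0 lw wC.
pose w' : {linear X -> R^o} :=
  HB.pack w (GRing.isLinear.Build R X R^o _ w lw).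
have cw : continuous w'.
  apply: bounded_linear_continuous; apply/ex_bound; exists C.
  apply/nbhs_norm0P; exists e => //= x xe /=; rewrite ler_norml wC// andbT lerNl.
  by rewrite -(linearN w') wC// normrN.
have wP : w \in @dual_pred R X by rewrite inE.
by exists (Dual wP).
Qed.

(** * Separation of convex relations *)

Section dual_arith.
Context {R : realType} {X : normedModType R}.
Implicit Types (v w : dual X) (x y : X).

Lemma dual_bound w x : - (`|w| * `|x|) <= w x <= `|w| * `|x|.
Proof. by rewrite -ler_norml; exact: dual_norm_le. Qed.

Lemma dual_add w x y : w (x + y) = w x + w y. Proof. exact: linearD. Qed.
Lemma dual_sub w x y : w (x - y) = w x - w y. Proof. exact: linearB. Qed.
Lemma dual_opp w x : w (- x) = - w x. Proof. exact: linearN. Qed.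
Lemma dual_scale w a x : w (a *: x) = a * w x. Proof. exact: linearZ. Qed.
Lemma dualB v w x : (v - w) x = v x - w x. Proof. by []. Qed.
Lemma dual_zero w : w 0 = 0. Proof. exact: linear0. Qed.

Lemma norm_conv_sub x y c (t : R) : 0 < t < 1 ->
  `|t *: x + (1 - t) *: y - c| <= t * `|x - c| + (1 - t) * `|y - c|.
Proof.
move=> /andP[t0 t1].
have -> : t *: x + (1 - t) *: y - c = t *: (x - c) + (1 - t) *: (y - c).
  by rewrite !scalerBr addrACA -opprD -scalerDl subrKC scale1r.
apply: le_trans (ler_normD _ _) _.
by rewrite !normrZ !ger0_norm//; lra.
Qed.

End dual_arith.

(** The relation replaces an extended-real function by its epigraph, so that
    heights are real numbers and no case of infinite value has to be treated. *)
Definition convex_rel (R : realType) (X : lmodType R) (A : X -> R -> Prop) :=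
  forall x y r s t, A x r -> A y s -> 0 < t < 1 ->
    A (t *: x + (1 - t) *: y) (t * r + (1 - t) * s).

Section sandwich.
Context {R : realType} {X : normedModType R}.
Variables (A B : X -> R -> Prop) (p : X) (C s0 e : R).
Hypotheses (cA : convex_rel A) (cB : convex_rel B).
Hypothesis AB : forall x r s, A x r -> B x s -> 0 <= r + s.
Hypotheses (e0 : 0 < e) (Ap : forall x, `|x - p| < e -> A x C) (Bp : B p s0).

(* The infimum of [S d] is the positively homogeneous hull of the infimal
   convolution [d |-> inf_{a - b = d} (r + s)], where [r] and [s] are heights
   over [a] and [b]. The convolution itself may be infinite away from [0];
   its hull is finite everywhere. *)
Let S (d : X) : set R := [set z | exists t a b r s,
  [/\ 0 < t, A a r, B b s, d = t *: (a - b) & z = t * (r + s)]].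

Let mix t1 t2 (a1 a2 : X) : X :=
  (t1 / (t1 + t2)) *: a1 + (1 - t1 / (t1 + t2)) *: a2.

Let mixr t1 t2 (r1 r2 : R) := t1 / (t1 + t2) * r1 + (1 - t1 / (t1 + t2)) * r2.

Let scale_mix t1 t2 a1 a2 : 0 < t1 -> 0 < t2 ->
  (t1 + t2) *: mix t1 t2 a1 a2 = t1 *: a1 + t2 *: a2.
Proof.
move=> t10 t20; rewrite scalerDr !scalerA; congr (_ *: _ + _ *: _); field; lra.
Qed.

Let mul_mixr t1 t2 r1 r2 : 0 < t1 -> 0 < t2 ->
  (t1 + t2) * mixr t1 t2 r1 r2 = t1 * r1 + t2 * r2.
Proof. by move=> t10 t20; rewrite /mixr; field; lra. Qed.

Let mix_rel D t1 t2 a1 a2 r1 r2 : convex_rel D -> 0 < t1 -> 0 < t2 ->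
  D a1 r1 -> D a2 r2 -> D (mix t1 t2 a1 a2) (mixr t1 t2 r1 r2).
Proof.
move=> cD t10 t20 D1 D2; apply: cD => //.
by rewrite divr_gt0 ?addr_gt0//= ltr_pdivrMr ?addr_gt0// mul1r ltrDl.
Qed.

Let SD d1 d2 z1 z2 : S d1 z1 -> S d2 z2 -> S (d1 + d2) (z1 + z2).
Proof.
move=> [t1 [a1 [b1 [r1 [s1 [t10 A1 B1 -> ->]]]]]].
move=> [t2 [a2 [b2 [r2 [s2 [t20 A2 B2 -> ->]]]]]].
exists (t1 + t2), (mix t1 t2 a1 a2), (mix t1 t2 b1 b2), (mixr t1 t2 r1 r2),
  (mixr t1 t2 s1 s2); split.
- exact: addr_gt0.
- exact: mix_rel.
- exact: mix_rel.
- by rewrite !scalerBr !scale_mix// opprD addrACA.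
- by rewrite [RHS]mulrDr !mul_mixr//; ring.
Qed.

Let S0 z : S 0 z -> 0 <= z.
Proof.
move=> [t [a [b [r [s [t0 Ar Bs /esym/eqP + ->]]]]]].
rewrite scaler_eq0 gt_eqF//= subr_eq0 => /eqP ab.
by rewrite mulr_ge0 ?(ltW t0)//; apply: AB Ar _; rewrite ab.
Qed.

Let SZ t d z : 0 < t -> S d z -> S (t *: d) (t * z).
Proof.
move=> t0 [u [a [b [r [s [u0 Ar Bs -> ->]]]]]].
exists (t * u), a, b, r, s; split=> //; first exact: mulr_gt0.
  by rewrite scalerA.
by rewrite mulrA.
Qed.

Let S_ball d : `|d| < e -> S d (C + s0).
Proof.
move=> de; exists 1, (p + d), p, C, s0; split=> //.
- by apply: Ap; rewrite addrAC subrr add0r.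
- by rewrite addrAC subrr add0r scale1r.
- by rewrite mul1r.
Qed.

Let S_nonempty d : S d !=set0.
Proof.
have [->|d0] := eqVneq d 0.
  by exists (C + s0); apply: S_ball; rewrite normr0.
have nd : 0 < `|d| by rewrite normr_gt0.
pose t := e / 2 / `|d|.
have t0 : 0 < t by rewrite !divr_gt0.
exists (t^-1 * (C + s0)).
rewrite -[d]scale1r -(mulVf (lt0r_neq0 t0)) -scalerA.
apply: SZ; first by rewrite invr_gt0.
by apply: S_ball; rewrite normrZ gtr0_norm// divfK ?gt_eqF//; have := e0; lra.
Qed.

Let S_has_inf d : has_inf (S d).
Proof.
split; first exact: S_nonempty.
have [z Sz] := S_nonempty (- d); exists (- z) => y Sy.
by have := S0 (eq_ind _ (S^~ (y + z)) (SD Sy Sz) _ (subrr d)); lra.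
Qed.

Let gauge d := inf (S d).

Let gauge_le d z : S d z -> gauge d <= z.
Proof. by move=> Sz; apply: ge_inf => //; exact: (S_has_inf d).2. Qed.

Let gauge_sublinear : sublinear gauge.
Proof.
split=> [x y|t x t0].
  rewrite -lerBlDr; apply: lb_le_inf; first exact: S_nonempty.
  move=> z1 S1; rewrite lerBlDr -lerBlDl.
  apply: lb_le_inf; first exact: S_nonempty.
  by move=> z2 S2; rewrite lerBlDl; apply: gauge_le; exact: SD.
apply/eqP; rewrite eq_le; apply/andP; split.
  rewrite -ler_pdivrMl//; apply: lb_le_inf; first exact: S_nonempty.
  by move=> z Sz; rewrite ler_pdivrMl//; apply/gauge_le/SZ.
apply: lb_le_inf; first exact: S_nonempty.
move=> z Sz; rewrite -ler_pdivlMl//; apply: gauge_le.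
rewrite -[x]scale1r -(mulVf (lt0r_neq0 t0)) -scalerA.
by apply: SZ => //; rewrite invr_gt0.
Qed.

(** A linear [w] below the gauge satisfies [w a - w b <= r + s] for all [(a, r)]
    in [A] and [(b, s)] in [B], which leaves room for a constant between
    [- s - w b] and [r - w a]. *)
Lemma convex_sandwich : exists (w : dual X) (c : R),
  (forall x r, A x r -> w x + c <= r) /\ (forall x s, B x s -> - s <= w x + c).
Proof.
have [w0 [lw wg]] := hahn_banach_sublinear gauge_sublinear.
have [|w ww0] := dual_of_bounded_above (C := C + s0) e0 lw.
  by move=> x /S_ball/gauge_le; apply: le_trans.
have wAB a b r s : A a r -> B b s -> w a - w b <= r + s.
  move=> Ar Bs; rewrite -dual_sub ww0; apply: le_trans (wg _) _; apply: gauge_le.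
  by exists 1, a, b, r, s; split=> //; rewrite ?scale1r ?mul1r.
pose T := [set z | exists x r, A x r /\ z = r - w x].
have Ap0 : A p C by apply: Ap; rewrite subrr normr0.
have Tinf : has_inf T.
  split; first by exists (C - w p), p, C.
  by exists (- s0 - w p) => _ [x [r [Ar ->]]]; have := wAB _ _ _ _ Ar Bp; lra.
exists w, (inf T); split=> [x r Ar|x s Bs].
  suff : inf T <= r - w x by lra.
  by apply: ge_inf; [exact: Tinf.2|exists x, r].
suff : - s - w x <= inf T by lra.
apply: lb_le_inf; first exact: Tinf.1.
by move=> _ [y [r [Ar ->]]]; have := wAB _ _ _ _ Ar Bs; lra.
Qed.

End sandwich.

(** * Subgradients, the sum rule and affine minorants *)

Lemma nbhs_distP (R : realType) (X : normedModType R) (p : X) (A : set X) :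
  nbhs p A <-> exists2 e, 0 < e & forall y, `|y - p| < e -> A y.
Proof.
split=> [/nbhs_ballP[e /= e0 eA]|[e e0 eA]].
  by exists e => // y ye; apply: eA; rewrite -ball_normE /= distrC.
apply/nbhs_ballP; exists e => //= y; rewrite -ball_normE /= distrC; exact: eA.
Qed.

Section ereal_functions.
Context {R : realType} {X : normedModType R}.
Implicit Types (f g : X -> \bar R) (x y : X) (u v w : dual X).

Definition epi f x (r : R) : Prop := (f x <= r%:E)%E.

Lemma econvex_epi f : econvex f -> convex_rel (epi f).
Proof.
move=> cf x y r s t fx fy t01; apply: le_trans (cf x y t t01) _.
have /andP[t0 t1] := t01.
by rewrite [leRHS]EFinD !EFinM; apply: leeD; apply: lee_wpmul2l => //;
  rewrite lee_fin; lra.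
Qed.

Lemma le_epi f x (z : R) : (-oo < f x)%E ->
  (forall r, epi f x r -> z <= r) -> (z%:E <= f x)%E.
Proof.
rewrite /epi; case: (f x) => [r _|_ _|//]; last exact: leey.
by move/(_ r (lexx _)); rewrite lee_fin.
Qed.

Lemma adde_gtNy (a b : \bar R) : (-oo < a)%E -> (-oo < b)%E -> (-oo < a + b)%E.
Proof. by rewrite !ltNye adde_eq_ninfty negb_or => -> ->. Qed.

Lemma mule_gtNy (t : R) (a : \bar R) : 0 < t -> (-oo < a)%E -> (-oo < t%:E * a)%E.
Proof.
move=> t0; case: a => [r||//] _; first by rewrite -EFinM ltNyr.
by rewrite gt0_muley ?lte_fin.
Qed.

Lemma edom_fine f x : (-oo < f x)%E -> edom f x -> f x = (fine (f x))%:E.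
Proof. by rewrite /edom /=; case: (f x). Qed.

Lemma subdiff_epiP f x u (a : R) : (forall y, (-oo < f y)%E) -> f x = a%:E ->
  subdiff f x u <-> (forall y r, epi f y r -> u (y - x) + a <= r).
Proof.
move=> fN fx; split=> [su y r|h y].
  by move=> /(le_trans (su y)); rewrite fx -EFinD lee_fin.
by rewrite fx -EFinD; apply: le_epi => // r; exact: h.
Qed.

Lemma subdiff_edom f x u : edom f !=set0 -> subdiff f x u -> edom f x.
Proof.
move=> [p fp] /(_ p); move: fp; rewrite /edom /=.
by case: (f x) (f p) => [r||] [s||] //=; rewrite ?ltry ?ltNyr// addey// leye_eq.
Qed.

(** The epigraph is separated from the vertical ray below its point over [x]. *)
Lemma subdiff_nonempty f x (C e : R) :
  (forall y, (-oo < f y)%E) -> econvex f -> 0 < e ->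
  (forall y, `|y - x| < e -> epi f y C) -> subdiff f x !=set0.
Proof.
move=> fN cf e0 fC.
have fx : f x = (fine (f x))%:E.
  apply: edom_fine => //; apply: le_lt_trans (fC x _) (ltry _).
  by rewrite subrr normr0.
set a := fine (f x) in fx.
have [|||w [c [wf wx]]] := @convex_sandwich R X (epi f)
    (fun y s => y = x /\ - a <= s) x C (- a) e (econvex_epi cf) _ _ e0 fC.
- move=> y z r s t [-> ar] [-> as_] /andP[t0 t1]; split.
    by rewrite -scalerDl addrCA subrr addr0 scale1r.
  by nra.
- move=> y r s fr [yx as_]; move: fr; rewrite yx /epi fx lee_fin; lra.
- by [].
exists w; apply/(subdiff_epiP _ fN fx) => y r /wf.
have := wx x (- a) (conj erefl (lexx _)); rewrite dual_sub; lra.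
Qed.

(** The affine function squeezed between [f] and
    [y |-> v (y - z) + f z + g z - g y] touches both at [z]: its slope is the
    subgradient of [f]. *)
Lemma subdiff_add f g z v (p : X) (C e : R) :
  (forall y, (-oo < f y)%E) -> (forall y, (-oo < g y)%E) ->
  econvex f -> econvex g -> 0 < e ->
  (forall y, `|y - p| < e -> epi f y C) -> edom g p ->
  subdiff (fun y => f y + g y)%E z v ->
  exists2 w, subdiff f z w & subdiff g z (v - w).
Proof.
move=> fN gN cf cg e0 fC gp sv.
have hN y : (-oo < f y + g y)%E by exact: adde_gtNy.
have fp : edom f p.
  by apply: le_lt_trans (fC p _) (ltry _); rewrite subrr normr0.
have : edom (fun y => f y + g y)%E z.
  apply: subdiff_edom sv; exists p; exact: lte_add_pinfty.
move=> hz.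
have [fz gz] : f z = (fine (f z))%:E /\ g z = (fine (g z))%:E.
  move: hz (fN z) (gN z); rewrite /edom /=.
  by case: (f z) (g z) => [?||] [?||].
set a := fine (f z) in fz; set b := fine (g z) in gz.
have sv' : forall y r s, epi f y r -> epi g y s -> v (y - z) + (a + b) <= r + s.
  move=> y r s fr gs.
  apply: ((@subdiff_epiP (fun y => f y + g y)%E z v (a + b) hN _).1 sv).
    by rewrite fz gz.
  by rewrite /epi EFinD; exact: leeD.
have [|||w [c [wf wg]]] := @convex_sandwich R X (epi f)
    (fun y s => epi g y (s + v (y - z) + (a + b)))
    p C (fine (g p) - v (p - z) - (a + b)) e (econvex_epi cf) _ _ e0 fC.
- move=> x y r s t gr gs t01.
  have := econvex_epi cg gr gs t01; congr (epi _ _ _).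
  by rewrite !dual_sub dual_add !dual_scale; ring.
- move=> y r s fr gs; have := sv' _ _ _ fr gs; lra.
- by rewrite addrAC subrK subrK /epi -edom_fine.
have wfz : w z + c <= a by apply: wf; rewrite /epi fz.
have wgz : a <= w z + c.
  have := wg z (- a); rewrite opprK; apply.
  by rewrite /epi gz lee_fin dual_sub; lra.
exists w.
  apply/(subdiff_epiP _ fN fz) => y r /wf; rewrite dual_sub; lra.
apply/(subdiff_epiP _ gN gz) => y s gs.
have := wg y (s - v (y - z) - (a + b)).
rewrite (_ : s - _ - _ + _ + _ = s); last ring.
move=> /(_ gs); rewrite !dual_sub !dualB; lra.
Qed.

(** Lower semicontinuity bounds [f] from below on a ball around [p]; along the
    segment from [p] to a point outside the ball convexity allows at most
    linear decrease. *)
Lemma norm_affine_minorant f p : Gamma0 f -> edom f p ->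
  exists n m : R, 0 <= n /\ forall y s, epi f y s -> m - n * `|y - p| <= s.
Proof.
move=> [fN _ lf cf] fp; have := edom_fine (fN p) fp.
set a := fine _ => fpa.
have [|V /nbhs_distP[d d0 dV] Vf] := lf p (a - 1).
  by rewrite fpa lte_fin; lra.
exists (2 / d), (a - 1); split; first by rewrite divr_ge0// ltW.
move=> y s fs; have [yd|yd] := ltP `|y - p| d.
  have : ((a - 1)%:E < s%:E)%E by apply: lt_le_trans (Vf _ (dV _ yd)) fs.
  rewrite lte_fin => as_.
  have : 0 <= 2 / d * `|y - p| by rewrite mulr_ge0// divr_ge0// ltW.
  lra.
have yp0 : 0 < `|y - p| by exact: lt_le_trans yd.
pose t := d / 2 / `|y - p|.
have t0 : 0 < t by rewrite !divr_gt0.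
have tE : t * `|y - p| = d / 2 by rewrite /t divfK ?gt_eqF.
have t1 : t < 1 by rewrite /t ltr_pdivrMr// mul1r; lra.
have : epi f (t *: y + (1 - t) *: p) (t * s + (1 - t) * a).
  by apply: econvex_epi => //; rewrite ?t0 ?t1// /epi fpa.
have : ((a - 1)%:E < f (t *: y + (1 - t) *: p)%R)%E.
  apply/Vf/dV; have -> : t *: y + (1 - t) *: p - p = t *: (y - p).
    by rewrite scalerBl scale1r scalerBr addrCA addrAC subrr add0r.
  by rewrite normrZ gtr0_norm// tE; lra.
move=> /lt_le_trans /[apply]; rewrite lte_fin => h.
have -> : 2 / d * `|y - p| = t^-1.
  by rewrite /t !invf_div; field; rewrite !gt_eqF.
have tK : t * t^-1 = 1 by rewrite mulfV ?gt_eqF.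
rewrite -(ler_pM2l t0) mulrBr tK; nra.
Qed.

(** A closed convex function is the supremum of its affine minorants. The
    minorant is squeezed between [f] and a downward cone [r - k * `|y - x|]:
    lower semicontinuity puts [f] above the cone near [x], and a large [k] does
    so elsewhere. Since the cone is finite everywhere, this works also when [x]
    is far from the domain of [f]. *)
Lemma affine_minorant f x (r : R) : Gamma0 f -> (r%:E < f x)%E ->
  exists w (c : R), (forall y s, epi f y s -> w y + c <= s) /\ r <= w x + c.
Proof.
move=> Gf rf; have [fN [p fp] lf cf] := Gf.
have [n [m [n0 nm]]] := norm_affine_minorant Gf fp.
have [V /nbhs_distP[d d0 dV] Vf] := lf x r rf.
(* Outside the ball of radius [d], the excess of [k] over [n] makes up for the
   difference between the two apices. *)
pose k := n + `|r - m + n * `|x - p| | / d.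
have kn : n <= k by rewrite lerDl divr_ge0// ltW.
have k0 : 0 <= k by exact: le_trans kn.
have kf y s : epi f y s -> r - k * `|y - x| <= s.
  move=> fs; have [yd|yd] := ltP `|y - x| d.
    have : (r%:E < s%:E)%E by apply: lt_le_trans (Vf _ (dV _ yd)) fs.
    rewrite lte_fin; have : 0 <= k * `|y - x| by rewrite mulr_ge0.
    lra.
  have h1 := nm _ _ fs.
  have h2 : n * `|y - p| <= n * `|y - x| + n * `|x - p|.
    by rewrite -mulrDr ler_wpM2l//; have := ler_distD x y p.
  have h3 : `|r - m + n * `|x - p| | <= (k - n) * `|y - x|.
    have -> : k - n = `|r - m + n * `|x - p| | / d by rewrite /k addrC addKr.
    by rewrite mulrAC ler_pdivlMr// ler_wpM2l.
  have h4 := ler_norm (r - m + n * `|x - p|).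
  lra.
have [||||||w [c [wA wB]]] := @convex_sandwich R X
    (fun y a => k * `|y - x| - r <= a) (epi f) p
    (k * (`|p - x| + 1) - r) (fine (f p)) 1.
- move=> y z a b t ya zb t01; have /andP[t0 t1] := t01.
  have := ler_wpM2l k0 (norm_conv_sub y z x t01); nra.
- exact: econvex_epi.
- by move=> y a s ya /kf; lra.
- exact: ltr01.
- move=> y yp; rewrite lerD2r ler_wpM2l//.
  by have := ler_distD p y x; lra.
- by rewrite /epi -edom_fine.
exists (- w), (- c); split=> [y s /wB|]; first by rewrite dualN; lra.
by have := wA x (- r); rewrite subrr normr0 mulr0 add0r dualN => /(_ (lexx _)); lra.
Qed.

End ereal_functions.

(** * Interior points of the domain on Banach spaces *)

Section complete.
Context {R : realType} {X : completeNormedModType R}.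

(** By Baire some sublevel set has interior near [p]; convexity transports the
    bound from that ball, centred at [q], to [p], the midpoint of [q] and its
    reflection. *)
Lemma Gamma0_bounded_above (f : X -> \bar R) (p : X) : Gamma0 f ->
  (edom f)° p -> exists (C e : R), 0 < e /\ forall y, `|y - p| < e -> epi f y C.
Proof.
move=> [fN _ lf cf] /nbhs_distP[r r0 rf].
(* The second set confines the search for [q] to a ball whose reflection in
   [p] still lies in the domain. *)
pose G (n : nat) := [set y | (n%:R%:E < f y)%E] `|` [set y : X | r / 2 < `|y - p|].
have oG n : open (G n).
  apply: openU; first exact: (lower_semicontinuousP f).1.
  rewrite openE => y /= yr; apply/nbhs_distP.
  exists (`|y - p| - r / 2); first lra.
  by move=> z zy /=; have := ler_distD z y p; rewrite (distrC y z); lra.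
have [n nd] : exists n, ~ dense (G n).
  apply: contrapT => /forallNP dG.
  have := @Baire R X G (fun n => conj (oG n) (contrapT (dG n))).
  move=> /(_ (ball p (r / 2))) [||y [py Gy]].
  - by exists p; apply: ballxx; lra.
  - exact: ball_open.
  have yp : `|y - p| < r / 2 by move: py; rewrite -ball_normE /= distrC.
  have fy := edom_fine (fN y) (rf y _).
  have [] := Gy (Num.bound `|fine (f y)|) I; last by rewrite /= ltNge (ltW yp).
  rewrite /= fy; last lra.
  have := archi_boundP (normr_ge0 (fine (f y))).
  by have := ler_norm (fine (f y)); rewrite lte_fin; lra.
have [q [s [s0 qs]]] : exists q s, 0 < s /\ forall y, `|y - q| < s -> ~ G n y.
  apply: contrapT => h; apply: nd => O [q Oq] oO; apply/set0P/negP => /eqP OG.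
  apply: h; have /nbhs_distP[s s0 sO] : nbhs q O by exact: open_nbhs_nbhs.
  exists q, s; split=> // y ys Gy; suff : set0 y by [].
  by rewrite -OG; split=> //; exact: sO.
have qf y : `|y - q| < s -> epi f y n%:R.
  by move=> /qs Gy; rewrite /epi leNgt; apply/negP => h; apply: Gy; left.
have qp : `|q - p| <= r / 2.
  rewrite leNgt; apply/negP => h; apply: (qs q); first by rewrite subrr normr0.
  by right.
pose q' := p + (p - q).
have fq' : f q' = (fine (f q'))%:E.
  apply: edom_fine => //; apply: rf; rewrite /q' addrC addKr distrC; lra.
exists (2^-1 * n%:R + (1 - 2^-1) * fine (f q')), (s / 2); split; first lra.
move=> y yp; have -> : y = 2^-1 *: (2 *: (y - p) + q) + (1 - 2^-1) *: q'.
  have -> : (1 - 2^-1 : R) = 2^-1 by field.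
  rewrite -scalerDr /q' -!addrA [q + _]addrCA [q + _]addrCA subrr addr0.
  have -> : p + p = 2 *: p by rewrite scaler_nat mulr2n.
  by rewrite -scalerDr subrK scalerA mulVf ?scale1r//; lra.
apply: econvex_epi; [by []| |by rewrite /epi -fq'|by lra].
by apply: qf; rewrite addrK normrZ ger0_norm; lra.
Qed.

(** Ekeland's variational principle, for the function equal to [h] on [D] and
    to infinity elsewhere; the closure hypothesis is its lower
    semicontinuity. Iterating a choice that halves the distance of [h] to its
    infimum over the improvements [S x] gives a Cauchy sequence whose limit
    admits no improvement. *)
Lemma ekeland (D : set X) (h : X -> R) (m e : R) (x0 : X) : 0 < e ->
  (forall y, D y -> m <= h y) ->
  (forall a v, (forall d, 0 < d -> exists y, [/\ D y, `|y - v| < d & h y <= a]) ->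
    D v /\ h v <= a) ->
  D x0 -> exists v, [/\ D v, h v <= h x0 &
    forall y, D y -> h v <= h y + e * `|y - v| ].
Proof.
move=> e0 hm Dcl Dx0.
pose S x := [set y | D y /\ h y + e * `|y - x| <= h x].
have S_refl x : D x -> S x x by move=> Dx; split=> //; rewrite subrr normr0; lra.
have S_trans x y z : S x y -> S y z -> S x z.
  move=> [Dy yx] [Dz zy]; split=> //.
  have := ler_distD y z x; rewrite -(ler_pM2l e0); lra.
have [next nextP] : exists next : X -> X, forall x, D x ->
    S x (next x) /\ forall y, S x y -> 2 * h (next x) - h x <= h y.
  suff /choice[g gP] : forall x, exists y, D x ->
      S x y /\ forall z, S x z -> 2 * h y - h x <= h z by exists g.
  move=> x; have [Dx|] := pselect (D x); last by exists x.
  pose I := [set h y | y in S x].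
  have Iinf : has_inf I.
    split; first by exists (h x), x => //; exact: S_refl.
    by exists m => _ [y [Dy _] <-]; exact: hm.
  have [hxI|hxI] := leP (h x) (inf I).
    exists x => _; split; first exact: S_refl.
    move=> z Sz; have : inf I <= h z by apply: ge_inf; [exact: Iinf.2|exists z].
    lra.
  have [|_ [y Sy <-] yI] := @inf_adherent R I ((h x - inf I) / 2) _ Iinf.
    by lra.
  exists y => _; split=> // z Sz.
  have : inf I <= h z by apply: ge_inf; [exact: Iinf.2|exists z].
  lra.
pose x n := iter n next x0.
have Dx n : D (x n).
  by elim: n => // n IH; exact: (nextP _ IH).1.1.
have Sx n k : S (x n) (x (n + k)%N).
  elim: k => [|k IH]; first by rewrite addn0; exact: S_refl.
  by rewrite addnS; apply: S_trans IH _; exact: (nextP _ (Dx _)).1.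
pose L := inf (range (h \o x)).
have Linf : has_inf (range (h \o x)).
  by split; [exists (h x0), 0%N|exists m => _ [n _ <-]; exact/hm/Dx].
have LP n : L <= h (x n) by apply: ge_inf; [exact: Linf.2|exists n].
have Ladh eta : 0 < eta -> exists n, h (x n) < L + eta.
  by move=> eta0; have [_ [n _ <-]] := inf_adherent eta0 Linf; exists n.
have /cvg_ex[v xv] : cvg (x @ \oo).
  apply/cauchy_cvgP; apply: cauchy_exP => d d0.
  have [N hN] := Ladh (e * d) (mulr_gt0 e0 d0).
  exists (x N); exists N => // n /= /subnKC <-; rewrite -ball_normE /= distrC.
  by have [_] := Sx N (n - N)%N; have := LP (N + (n - N))%N; rewrite -(ltr_pM2l e0); lra.
have near_v n d : 0 < d -> exists k, `|x (n + k)%N - v| < d.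
  move=> d0; have /cvgrPdist_lt/(_ d d0)[N _ NP] := xv.
  by exists N; rewrite distrC; apply: NP => /=; exact: leq_addl.
have Sv n : S (x n) v.
  have h_eta eta : 0 < eta -> D v /\ h v <= h (x n) - e * `|v - x n| + eta.
    move=> eta0; apply: Dcl => d d0.
    have [|k] := near_v n (Order.min d (eta / e)).
      by rewrite lt_min d0 divr_gt0.
    rewrite lt_min => /andP[kd]; rewrite ltr_pdivlMr// mulrC => ke.
    exists (x (n + k)%N); split=> //.
    have [_] := Sx n k; have := ler_distD (x (n + k)%N) v (x n).
    by rewrite -(ler_pM2l e0) (distrC v (x (n + k)%N)); lra.
  split; first exact: (h_eta 1 ltr01).1.
  by apply/ler_addgt0Pr => eta /h_eta[]; lra.
exists v; split; first exact: (Sv 0).1.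
  have [_] := Sv 0; rewrite /x /=.
  have : 0 <= e * `|v - x0| by rewrite mulr_ge0// ltW.
  lra.
move=> y Dy; rewrite leNgt; apply/negP => yv.
have Svy : S v y by split=> //; exact: ltW.
have hvL : h v <= L.
  apply: lb_le_inf; first exact: Linf.1.
  move=> _ [n _ <-] /=; have [_] := Sv n.
  have : 0 <= e * `|v - x n| by rewrite mulr_ge0// ltW.
  lra.
have Ly : L <= h y.
  apply/ler_addgt0Pr => eta eta0; have [n hn] := Ladh eta eta0.
  have := (nextP _ (Dx n)).2 y (S_trans _ _ _ (Sv n) Svy).
  by have := LP n.+1; rewrite /x /= -/(x n); lra.
have : 0 <= e * `|y - v| by rewrite mulr_ge0// ltW.
lra.
Qed.

(** Let [w] be close to [x] and penalise the distance to [w] with a slope [n]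
    such that [n - 1] exceeds a bound [M] on the subgradients near [x].
    Ekeland's principle gives an almost minimiser [v] of the penalised
    function; if [v] were not [w], the sum rule would produce a subgradient at
    [v] whose norm is at least [n - 1]. Hence [v = w], and [F] is finite at
    [w]. *)
Lemma interior_of_locally_bounded_subdiff (F : X -> \bar R) (x : X) : Gamma0 F ->
  locally_bounded_on_dom (subdiff F) -> dom_op (subdiff F) x -> (edom F)° x.
Proof.
move=> GF lbF dx; have [FN Fne lF cF] := GF.
have [W /nbhs_distP[r r0 rW] /pinfty_ex_gt0[M /ltW M_ge0 WM0]] := lbF x dx.
have WM y u : `|y - x| < r -> subdiff F y u -> `|u| <= M.
  by move=> /rW Wy uy; apply: WM0; exists y.
have [xi xxi] := dx.
have xiM : `|xi| <= M by apply: WM xxi; rewrite subrr normr0.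
have Fx := edom_fine (FN x) (subdiff_edom Fne xxi).
set a := fine (F x) in Fx.
have minor y s : epi F y s -> a - M * `|y - x| <= s.
  move=> /((subdiff_epiP _ FN Fx).1 xxi).
  have /andP[+ _] := dual_bound xi (y - x).
  have : `|xi| * `|y - x| <= M * `|y - x| by rewrite ler_wpM2r.
  lra.
(* Comparing the penalised function at [v] and [x] gives
   [`|v - w| <= 3 * `|w - x|], so [v] stays within [r] of [x]. *)
apply/nbhs_distP; exists (r / 4); first lra.
move=> w wx.
pose n := 2 * M + 2.
have n0 : 0 < n by rewrite /n; lra.
pose h y := fine (F y) + n * `|y - w|.
have h_ge y : edom F y -> a - M * `|w - x| + (n - M) * `|y - w| <= h y.
  move=> Dy; have := minor y (fine (F y)).
  rewrite /epi -edom_fine// => /(_ (lexx _)); rewrite /h.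
  have := ler_wpM2l M_ge0 (ler_distD w y x); lra.
have Dx : edom F x by rewrite /edom /= Fx ltry.
have [|||v [Dv vx vmin]] := @ekeland (edom F) h (a - M * `|w - x|) 1 x ltr01.
- move=> y /h_ge; have : 0 <= (n - M) * `|y - w|.
    by rewrite mulr_ge0// /n; lra.
  lra.
- move=> b v bv.
  have vb eta : 0 < eta -> epi F v (b - n * `|v - w| + eta).
    move=> eta0; rewrite /epi leNgt; apply/negP => /(lF v)[V].
    move=> /nbhs_distP[d d0 dV] Vb.
    have [|y [Dy]] := bv (Order.min d (eta / n)).
      by rewrite lt_min d0 divr_gt0.
    rewrite lt_min ltr_pdivlMr// => /andP[/dV/Vb + yv].
    rewrite (edom_fine (FN y) Dy) lte_fin /h.
    have := ler_distD y v w; rewrite -(ler_pM2l n0) (distrC v y).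
    lra.
  have Dv : edom F v by apply: le_lt_trans (vb 1 ltr01) (ltry _).
  split=> //; apply/ler_addgt0Pr => eta /vb.
  by rewrite /epi (edom_fine (FN v) Dv) lee_fin /h; lra.
- exact: Dx.
have [->//|wv] := eqVneq w v.
have vr : `|v - x| < r.
  have := h_ge _ Dv; move: vx; rewrite {2}/h -/a (distrC x w) => h1 h2.
  have h3 : (M + 2) * (`|v - w| - 3 * `|w - x|) <= 0.
    have := normr_ge0 (w - x); rewrite /n in h1 h2; nra.
  have h4 : `|v - w| <= 3 * `|w - x|.
    by rewrite pmulr_rle0 in h3; lra.
  have := ler_distD w v x; lra.
pose G (y : X) : \bar R := (n * `|y - w| + `|y - v|)%:E.
have cG : econvex G.
  move=> y z t t01; rewrite -!EFinM -EFinD lee_fin.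
  have := norm_conv_sub y z v t01.
  have := ler_wpM2l (ltW n0) (norm_conv_sub y z w t01); lra.
have [|||u uG uF] := @subdiff_add R X G F v 0 v (n * (`|v - w| + 1) + 1) 1
    _ FN cG cF ltr01 _ Dv.
- by move=> y; rewrite ltNyr.
- move=> y yv; rewrite /epi lee_fin lerD ?(ltW yv)// ler_pM2l//.
  by have := ler_distD v y w; lra.
- move=> y; rewrite dual0 add0e (edom_fine (FN v) Dv) {1}/G -EFinD.
  apply: (@le_epi _ _ (fun y => G y + F y)%E).
    by apply: adde_gtNy; rewrite ?ltNyr.
  move=> s; rewrite /epi /G; case Fy : (F y) => [b||] //.
    rewrite -EFinD lee_fin subrr normr0 addr0.
    have := vmin y; rewrite /h Fy /= mul1r => /(_ _)/wrap[]; first by rewrite /edom /= Fy ltry.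
    lra.
  by have := FN y; rewrite Fy.
have uM : `|u| <= M by rewrite -normrN -sub0r; exact: WM uF.
have := uG w; rewrite /G !subrr !normr0 mulr0 add0r addr0 -EFinD lee_fin.
have wv0 : 0 < `|w - v| by rewrite normr_gt0 subr_eq0.
have /andP[+ _] := dual_bound u (w - v).
have := ler_wpM2r (ltW wv0) uM.
rewrite (distrC v w) /n; nra.
Qed.

End complete.

(** * Completeness of the dual *)

Section dual_complete.
Context {R : realType} {X : normedModType R}.

Lemma dual_norm_bound (v : dual X) (M : R) : 0 <= M ->
  (forall x, `|v x| <= M * `|x|) -> `|v| <= M.
Proof.
move=> M0 vM; apply: dual_norm_lub => x x1; apply: le_trans (vM x) _.
by rewrite -[leRHS]mulr1 ler_wpM2l.
Qed.

(** The limit is taken pointwise; the estimate [l_ball], which passes to the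
    pointwise limit, makes it continuous and turns pointwise into norm
    convergence. *)
Lemma dual_cauchy_cvg (F : set_system (dual X)) : ProperFilter F ->
  cauchy F -> cvg F.
Proof.
move=> FF /cauchyP cF.
have norm_app (u v : dual X) x : `|u x - v x| <= `|u - v| * `|x|.
  by rewrite -dualB; exact: dual_norm_le.
have lP x : exists l : R, (fun u : dual X => u x) @ F --> l.
  apply/cvg_ex; apply/cauchy_cvgP; apply: cauchy_exP => e e0.
  have [u uF] := cF (e / (`|x| + 1)) (divr_gt0 e0 (ltr_wpDl (normr_ge0 x) ltr01)).
  exists (u x); suff : F [set v : dual X | ball (u x) e (v x)] by [].
  apply: filterS uF => v; rewrite -!ball_normE /=.
  rewrite ltr_pdivlMr ?ltr_wpDl// => uv.
  apply: le_lt_trans (norm_app u v x) _; apply: le_lt_trans uv.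
  by rewrite ler_wpM2l// lerDl.
have [l lF] := choice lP.
have l_ball u d x : F (ball u d) -> `|l x - u x| <= d * `|x|.
  move=> Fu; apply/ler_addgt0Pr => e e0.
  have Fx : F [set v : dual X | `|l x - v x| < e].
    by have /cvgrPdist_lt/(_ e e0) := lF x.
  have [v [/= vx]] := filter_ex (filterI Fx Fu).
  rewrite -ball_normE /= distrC => /ltW uv.
  have := norm_app v u x; have := ler_wpM2r (normr_ge0 x) uv.
  have := ler_distD (v x) (l x) (u x); lra.
have linl : linear (l : X -> R^o).
  move=> a x y; apply/esym.
  have h : (fun u : dual X => u (a *: x + y)) @ F --> (a *: l x + l y : R^o).
    under eq_fun do rewrite dual_add dual_scale.
    by apply: cvgD; [apply: cvgZl_tmp; exact: lF|exact: lF].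
  exact: cvg_unique h (lF _).
have [u0 Fu0] := cF 1 ltr01.
have [|v vl] := dual_of_bounded_above (C := `|u0| + 1) ltr01 linl.
  move=> x x1; have := l_ball _ _ x Fu0; rewrite mul1r ler_norml => /andP[_].
  have /andP[_] := dual_bound u0 x.
  have : `|u0| * `|x| <= `|u0| * 1 by rewrite ler_wpM2l// ltW.
  lra.
apply/cvg_ex; exists v; apply/cvgrPdist_lt => e e0.
have e3 : 0 < e / 3 by lra.
have [u Fu] := cF (e / 3) e3.
have vu : `|v - u| <= e / 3.
  apply: dual_norm_bound => [|x]; first exact: ltW.
  by rewrite dualB vl; exact: l_ball.
apply: filterS Fu => t; rewrite -ball_normE /= => ut.
have := ler_distD u v t; lra.
Qed.

HB.instance Definition _ :=
  Uniform_isComplete.Build (dual X) dual_cauchy_cvg.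

Lemma dual_eval (x : X) : exists xi : dual (dual X), forall u, xi u = u x.
Proof.
apply: (@dual_of_bounded_above R (dual X) (fun u => u x) `|x| 1) => // u u1.
have /andP[_] := dual_bound u x.
have : `|u| * `|x| <= 1 * `|x| by rewrite ler_wpM2r// ltW.
lra.
Qed.

End dual_complete.

(** * Conjugates *)

Section conjugate.
Context {R : realType} {X : normedModType R}.
Implicit Types (f g : X -> \bar R) (x y : X) (u v w : dual X).

Lemma epi_conjugate f u (M : R) : (forall x, (-oo < f x)%E) ->
  epi (conjugate f) u M <-> (forall y r, epi f y r -> u y - r <= M).
Proof.
move=> fN; split=> [fM y r fr|h].
  rewrite -lee_fin; apply: le_trans fM; apply: le_trans (ereal_sup_ubound _).
    2: by exists y.
  by rewrite EFinB leeB.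
apply: ge_ereal_sup => _ [y _ <-].
case fy : (f y) => [r||]; last by have := fN y; rewrite fy.
  by rewrite -EFinB lee_fin; apply: h; rewrite /epi fy.
by rewrite /= leNye.
Qed.

Lemma conjugate_ge f u x : ((u x)%:E - f x <= conjugate f u)%E.
Proof. by apply: ereal_sup_ubound; exists x. Qed.

Lemma conjugate_gtNy f u : edom f !=set0 -> (-oo < conjugate f u)%E.
Proof.
move=> [p]; rewrite /edom /= => fp; apply: lt_le_trans (conjugate_ge f u p).
by case: (f p) fp => [r||] //= _; rewrite ?ltNyr ?ltNyy.
Qed.

Lemma Gamma0_conjugate f : (forall x, (-oo < f x)%E) -> edom f !=set0 ->
  edom (conjugate f) !=set0 -> Gamma0 (conjugate f).
Proof.
move=> fN fne cne; split=> //; first by move=> u; exact: conjugate_gtNy.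
- move=> u a /ereal_sup_gt[_ [x _ <-] ax].
  have fx : edom f x.
    by move: ax; rewrite /edom /=; case: (f x) => [r||] //; rewrite ltry.
  move: ax; rewrite (edom_fine (fN x) fx) -EFinB lte_fin => ax.
  exists [set v : dual X | a < v x - fine (f x)].
    have x1 : 0 < `|x| + 1 by rewrite ltr_wpDl.
    apply/nbhs_distP; exists ((u x - fine (f x) - a) / (`|x| + 1)).
      by rewrite divr_gt0 ?subr_gt0.
    move=> v; rewrite ltr_pdivlMr//= => vu.
    have /andP[+ _] := dual_bound (v - u) x; rewrite dualB.
    have := normr_ge0 (v - u); lra.
  move=> v /= av; apply: lt_le_trans (conjugate_ge f v x).
  by rewrite (edom_fine (fN x) fx) -EFinB lte_fin.
- move=> u v t t01; have /andP[t0 t1] := t01.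
  apply: ge_ereal_sup => _ [x _ <-].
  have [fx|fx] := pselect (edom f x); last first.
    have -> : f x = +oo%E.
      by apply/eqP; rewrite eq_le leey leNgt; apply/negP.
    by rewrite leNye.
  have fE := edom_fine (fN x) fx.
  apply: (@le_trans _ _ (t%:E * ((u x)%:E - f x) + (1 - t)%:E * ((v x)%:E - f x))%E).
    by rewrite fE -!EFinB -!EFinM -EFinD lee_fin dualD !dualZ; lra.
  by apply: leeD; apply: lee_wpmul2l; rewrite ?lee_fin; try exact: conjugate_ge; lra.
Qed.

Lemma edom_conjugate_nonempty f : Gamma0 f -> edom (conjugate f) !=set0.
Proof.
move=> Gf; have [fN [p fp] _ _] := Gf.
have [|w [c [wf _]]] := @affine_minorant _ _ f p (fine (f p) - 1) Gf.
  by rewrite {2}(edom_fine (fN p) fp) lte_fin; lra.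
exists w; apply: (@le_lt_trans _ _ (- c)%:E); last exact: ltry.
by apply/(epi_conjugate _ _ fN) => y r /wf; lra.
Qed.

Lemma subdiff_conjugate f x u (xi : dual (dual X)) :
  (forall x, (-oo < f x)%E) -> edom f !=set0 ->
  (forall v, xi v = v x) -> subdiff f x u ->
  edom (conjugate f) u /\ subdiff (conjugate f) u xi.
Proof.
move=> fN fne xiE fxu.
have fx := edom_fine (fN x) (subdiff_edom fne fxu).
have cu : conjugate f u = (u x - fine (f x))%:E.
  apply/eqP; rewrite eq_le; apply/andP; split.
    apply/(epi_conjugate _ _ fN) => y r.
    by move=> /((subdiff_epiP u fN fx).1 fxu); rewrite dual_sub; lra.
  by apply: le_trans (conjugate_ge f u x); rewrite {2}fx.
split; first by rewrite /edom /= cu ltry.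
move=> v; rewrite cu xiE -EFinD; apply: le_trans (conjugate_ge f v x).
by rewrite fx -EFinB lee_fin dualB; lra.
Qed.

End conjugate.

(** A subgradient of [conjugate h] at [v] is evaluation at some [z]. Were [h z]
    above [v z - conjugate h v], an affine minorant of [h] with a larger value
    at [z] would contradict the subgradient inequality at its own slope. *)
Lemma subdiff_surj_interior_conjugate (R : realType) (X : normedModType R)
    (h : X -> \bar R) (v : dual X) : reflexive_space X -> Gamma0 h ->
  (edom (conjugate h))° v -> exists z, subdiff h z v.
Proof.
move=> Xrefl Gh hv; have [hN hne lh ch] := Gh.
have Gc : Gamma0 (conjugate h).
  apply: Gamma0_conjugate => //; exact: edom_conjugate_nonempty.
have [cN cne _ cc] := Gc.
have [C [e [e0 eC]]] := @Gamma0_bounded_above R (dual X) _ v Gc hv.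
have [Phi Phiv] := subdiff_nonempty cN cc e0 eC.
have [z zE] := Xrefl Phi.
have cv := edom_fine (cN v) (interior_subset hv).
set b := fine (conjugate h v) in cv.
have zP w M : epi (conjugate h) w M -> w z - v z + b <= M.
  by move=> /((subdiff_epiP Phi cN cv).1 Phiv); rewrite dual_sub !zE.
have hz : epi h z (v z - b).
  rewrite /epi leNgt; apply/negP => hz.
  have [r r1 r2] : exists2 r : R, v z - b < r & (r%:E < h z)%E.
    move: hz; case: (h z) (hN z) => [s||//] _.
      rewrite lte_fin => ?; exists ((s + (v z - b)) / 2); first lra.
      by rewrite lte_fin; lra.
    by exists (v z - b + 1); [lra|exact: ltry].
  have [w [c [wh wz]]] := affine_minorant Gh r2.
  suff /zP : epi (conjugate h) w (- c) by lra.
  by apply/(epi_conjugate _ _ hN) => y s /wh; lra.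
have bP : forall y r, epi h y r -> v y - r <= b.
  by apply/(epi_conjugate _ _ hN); rewrite /epi -cv.
exists z => y; have [hy|hy] := pselect (edom h y); last first.
  have -> : h y = +oo%E by apply/eqP; rewrite eq_le leey leNgt; apply/negP.
  exact: leey.
apply: (@le_trans _ _ ((v (y - z))%:E + (v z - b)%:E)%E); first exact: leeD.
have := bP y (fine (h y)); rewrite /epi -edom_fine// => /(_ (lexx _)).
by rewrite {2}(edom_fine (hN y) hy) -EFinD lee_fin dual_sub; lra.
Qed.

(** * Gateaux differentiability *)

Section gateaux.
Context {R : realType} {X : normedModType R}.
Variables (f : X -> \bar R) (z : X) (w : dual X) (C e : R).
Hypotheses (fN : forall y, (-oo < f y)%E) (cf : econvex f) (e0 : 0 < e).
Hypothesis fC : forall y, `|y - z| < e -> epi f y C.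
Hypotheses (fw : subdiff f z w) (w_uniq : forall v, subdiff f z v -> v = w).

Let a := fine (f z).

Let fz : f z = a%:E.
Proof.
apply: edom_fine => //; apply: le_lt_trans (fC _) (ltry _).
by rewrite subrr normr0.
Qed.

Let wP y r : epi f y r -> w (y - z) + a <= r.
Proof. exact: (subdiff_epiP w fN fz).1. Qed.

(** If every difference quotient along [h] exceeded [w h + eps], the half-line
    of that slope through the point of the graph would lie below [f], and
    separating the two would give a second subgradient. *)
Let slope_attained (h : X) (eps : R) : 0 < eps ->
  exists2 t, 0 < t & epi f (z + t *: h) (a + t * (w h + eps)).
Proof.
move=> eps0; apply: contrapT => nt.
have ray t r : 0 <= t -> epi f (z + t *: h) r -> a + t * (w h + eps) <= r.
  rewrite le_eqVlt => /predU1P[<-|t0] fr.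
    by have := wP fr; rewrite scale0r addr0 subrr dual_zero mul0r; lra.
  rewrite leNgt; apply/negP => rt; apply: nt; exists t => //.
  by apply: le_trans fr _; rewrite lee_fin ltW.
have [||||||w' [c [w'f w'r]]] := @convex_sandwich R X (epi f)
    (fun y s => exists2 t, 0 <= t & y = z + t *: h /\ - (a + t * (w h + eps)) <= s)
    z C (- a) e.
- exact: econvex_epi.
- move=> x y r s t [t1 t10 [-> rt1]] [t2 t20 [-> st2]] /andP[t0 lt1].
  exists (t * t1 + (1 - t) * t2).
    by rewrite addr_ge0// mulr_ge0//; lra.
  split; last by nra.
  rewrite !scalerDr addrACA -scalerDl subrKC scale1r; congr (_ + _).
  by rewrite !scalerA scalerDl.
- by move=> y r s fr [t t0 [yE st]]; move: fr; rewrite yE => /(ray _ _ t0); lra.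
- exact: e0.
- exact: fC.
- by exists 0 => //; rewrite scale0r addr0 mul0r addr0.
have w'z : w' z + c <= a by apply: w'f; rewrite /epi fz.
have w'z' : a <= w' z + c.
  by have := w'r z (- a); rewrite opprK; apply; exists 0 => //;
     rewrite scale0r addr0 mul0r addr0.
have w'w : w' = w.
  apply: w_uniq; apply/(subdiff_epiP _ fN fz) => y r /w'f.
  by rewrite dual_sub; lra.
have := w'r (z + h) (- (a + (w h + eps))).
rewrite opprK dual_add w'w => /(_ _)/wrap[]; last by rewrite w'w in w'z w'z'; lra.
by exists 1 => //; rewrite scale1r mul1r.
Qed.

(* By convexity the quotient at the attained [d] bounds all earlier ones. *)
Let quotient_right (h : X) (eps : R) : 0 < eps -> exists2 d, 0 < d &
  forall t, 0 < t -> t < d ->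
    0 <= t^-1 * (fine (f (t *: h + z)) - a) - w h <= eps.
Proof.
move=> eps0; have [d d0 fd] := slope_attained h eps0; exists d => // t t0 td.
have ft : epi f (t *: h + z) (a + t * (w h + eps)).
  have := econvex_epi cf fd (_ : epi f z a); rewrite {1}/epi fz.
  move=> /(_ (t / d) (lexx _)); rewrite divr_gt0//= ltr_pdivrMr// mul1r.
  move=> /(_ td); congr (epi _ _ _); last by field; rewrite gt_eqF.
  rewrite scalerDr addrAC -scalerDl subrKC scale1r scalerA divfK ?gt_eqF//.
  exact: addrC.
have fE := edom_fine (fN (t *: h + z)) (le_lt_trans ft (ltry _)).
have ge := wP (_ : epi f (t *: h + z) (fine (f (t *: h + z)))).
rewrite {1}/epi -fE in ge; move: (ge (lexx _)); rewrite addrK dual_scale => {}ge.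
move: ft; rewrite /epi fE lee_fin => le.
rewrite subr_ge0 lerBlDl ler_pdivlMl// ler_pdivrMl//.
by apply/andP; split; lra.
Qed.

Lemma subdiff_is_derive h : is_derive z h (fine \o f : X -> R^o) (w h).
Proof.
have lim : (fun t : R => t^-1 *: (((fine \o f : X -> R^o) \o shift z) (t *: h)
    - (fine \o f : X -> R^o) z)) @ 0^' --> (w h : R^o).
  apply/cvgrPdist_le => eps eps0.
  have [d d0 dP] := quotient_right h eps0.
  have [d' d'0 d'P] := quotient_right (- h) eps0.
  exists (Order.min d d') => /=; first by rewrite lt_min d0.
  move=> t; rewrite /= distrC subr0 lt_min => /andP[td td'] t0.
  rewrite -/a /= -[_ *: _]/(_ * _).
  have [tn|tp|t0'] := ltgtP t 0; last by rewrite t0' eqxx in t0.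
    rewrite ltr0_norm// in td'; have := d'P (- t); rewrite oppr_gt0 => /(_ tn td').
    by rewrite scaleNr scalerN opprK invrN mulNr dual_opp ler_norml; lra.
  rewrite gtr0_norm// in td; have := dP t tp td.
  by rewrite ler_norml; lra.
split; first by apply/cvg_ex; exists (w h).
exact: cvg_lim lim.
Qed.

End gateaux.

Section nabla.
Context {R : realType} {X : completeNormedModType R}.
Variables (f : X -> \bar R).
Hypotheses (Gf : Gamma0 f) (sf : single_valued_on_dom (subdiff f)).

(** At an interior point a unique subgradient is the Gateaux derivative;
    conversely a Gateaux derivative equals that of a subgradient, which exists
    there. *)
Lemma nabla_subdiff z u : nabla f z u <-> (edom f)° z /\ subdiff f z u.
Proof.
have [fN _ _ cf] := Gf.
suff h w : (edom f)° z -> subdiff f z w -> nabla f z w.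
  split=> [[fz du]|[]]; last exact: h.
  split=> //; have [C [e [e0 fC]]] := Gamma0_bounded_above Gf fz.
  have [w zw] := subdiff_nonempty fN cf e0 fC.
  suff -> : u = w by [].
  have [_ dw] := h w fz zw; apply/val_inj/funext => x.
  by rewrite -[LHS](@derive_val _ _ _ _ _ _ _ (du x)) (@derive_val _ _ _ _ _ _ _ (dw x)).
move=> fz zw; split=> // x; have [C [e [e0 fC]]] := Gamma0_bounded_above Gf fz.
by apply: (subdiff_is_derive fN cf e0 fC zw) => v zv; exact: sf zv zw.
Qed.

Lemma nabla_interior z : (edom f)° z -> exists u, nabla f z u.
Proof.
move=> fz; have [fN _ _ cf] := Gf.
have [C [e [e0 fC]]] := Gamma0_bounded_above Gf fz.
by have [u zu] := subdiff_nonempty fN cf e0 fC; exists u; apply/nabla_subdiff.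
Qed.

Lemma bregman_nabla y z u : nabla f z u ->
  bregman f y z = (f y - f z - (u (y - z))%:E)%E.
Proof.
move=> zu; have [fz _] := zu; rewrite /bregman; case: asboolP => // _.
have /nabla_subdiff[_ su] := zu.
have -> // : xget 0 (nabla f z) = u.
by case: xgetP => [v _ /nabla_subdiff[_ sv]|/(_ u)//]; exact: sf sv su.
Qed.

End nabla.

(** * Sums, multiples and tilts of convex functions *)

Section scaling.
Context {R : realType} {X : normedModType R}.
Implicit Types (f g phi : X -> \bar R) (u v : dual X) (gamma : R).

Lemma epi_econvex f : (forall x, (-oo < f x)%E) -> convex_rel (epi f) -> econvex f.
Proof.
move=> fN cf x y t t01; have /andP[t0 t1] := t01.
have t1' : (0 < (1 - t)%:E)%E by rewrite lte_fin subr_gt0.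
have := cf x y _ _ t _ _ t01; rewrite /epi.
move: (fN x) (fN y); case: (f x) (f y) => [a||] [b||] // _ _.
- by move=> /(_ a b (lexx _) (lexx _)); rewrite EFinD !EFinM.
- by rewrite gt0_muley// addey ?leey.
- by rewrite gt0_muley ?lte_fin// addye ?leey.
- by rewrite !gt0_muley ?lte_fin// addye ?leey.
Qed.

Lemma epi_scale_tilt phi u gamma y r : 0 < gamma -> (-oo < phi y)%E ->
  epi (fun y => gamma%:E * (phi y - (u y)%:E))%E y r <->
  epi phi y (gamma^-1 * r + u y).
Proof.
move=> g0; rewrite /epi; case: (phi y) => [s|_|//]; last first.
  by rewrite /= gt0_muley ?lte_fin// leye_eq.
by rewrite -EFinB -EFinM !lee_fin -ler_pdivlMl// lerBlDr.
Qed.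

Lemma subdiff_scale_tilt phi u gamma z v : 0 < gamma -> Gamma0 phi ->
  subdiff (fun y => gamma%:E * (phi y - (u y)%:E))%E z v <->
  subdiff phi z (gamma^-1 *: v + u).
Proof.
move=> g0 [pN [p pp] _ _]; set g := fun y => _.
have gE y s : epi g y s <-> epi phi y (gamma^-1 * s + u y).
  exact: epi_scale_tilt.
have gN y : (-oo < g y)%E.
  rewrite /g; case: (phi y) (pN y) => [r||//] _; first by rewrite -EFinB -EFinM ltNyr.
  by rewrite gt0_muley ?lte_fin.
have gp : edom g p.
  rewrite /edom /= /g (edom_fine (pN p) pp) -EFinB -EFinM; exact: ltry.
have dom : edom g z <-> edom phi z.
  split=> dz.
    apply: le_lt_trans ((gE z (fine (g z))).1 _) (ltry _).
    by rewrite /epi -edom_fine.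
  rewrite /edom /= /g (edom_fine (pN z) dz) -EFinB -EFinM; exact: ltry.
suff key : edom phi z -> subdiff g z v <-> subdiff phi z (gamma^-1 *: v + u).
  split=> h; apply/key => //; last by apply: subdiff_edom h; exists p.
  by apply/dom; apply: subdiff_edom h; exists p.
move=> dz; have zE := edom_fine (pN z) dz; set b := fine (phi z) in zE.
have gz : g z = (gamma * (b - u z))%:E by rewrite /g zE -EFinB -EFinM.
split=> [/(subdiff_epiP v gN gz) h|/(subdiff_epiP _ pN zE) h].
  apply/(subdiff_epiP _ pN zE) => y r pr.
  have := h y (gamma * (r - u y)); rewrite gE mulKf ?gt_eqF// subrK => /(_ pr).
  rewrite dualD dualZ !dual_sub => {}h.
  rewrite -(ler_pM2l g0) !mulrDr !mulVKf ?gt_eqF//; lra.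
apply/(subdiff_epiP v gN gz) => y r /gE /h.
rewrite dualD dualZ !dual_sub -(ler_pM2l g0) !mulrDr !mulVKf ?gt_eqF//; lra.
Qed.

Lemma subdiff_scale phi gamma z v : 0 < gamma -> Gamma0 phi ->
  subdiff (fun y => gamma%:E * phi y)%E z v <-> subdiff phi z (gamma^-1 *: v).
Proof.
move=> g0 Gp; rewrite -[_ *: v]addr0 -subdiff_scale_tilt//.
by under [X in _ <-> subdiff X _ _]eq_fun do rewrite dual0 sube0.
Qed.

Lemma Gamma0_scale phi gamma : 0 < gamma -> Gamma0 phi ->
  Gamma0 (fun y => gamma%:E * phi y)%E.
Proof.
move=> g0 [pN [p pp] lp cp]; split.
- by move=> x; exact: mule_gtNy.
- exists p; rewrite /edom /= (edom_fine (pN p) pp) -EFinM; exact: ltry.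
- move=> x a; rewrite -lte_pdivrMl// -EFinM => /lp[V xV VP].
  by exists V => // y /VP; rewrite EFinM lte_pdivrMl.
- apply: epi_econvex.
    by move=> x; exact: mule_gtNy.
  move=> x y r s t; rewrite /epi -!lee_pdivlMl// -!EFinM => xr ys t01.
  have := econvex_epi cp xr ys t01; rewrite /epi; congr (_ <= _%:E)%E; ring.
Qed.

Lemma Gamma0_add f g : Gamma0 f -> Gamma0 g ->
  edom f `&` edom g !=set0 -> Gamma0 (fun y => f y + g y)%E.
Proof.
move=> [fN _ lf cf] [gN _ lg cg] [p [fp gp]]; split.
- by move=> x; exact: adde_gtNy.
- by exists p; exact: lte_add_pinfty.
- move=> x a afg.
  have [b fb gb] : exists2 b : R, (b%:E < f x)%E & ((a - b)%:E < g x)%E.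
    move: afg (fN x) (gN x); case: (f x) (g x) => [r||] [s||] // h _ _.
    + exists (r - (r + s - a) / 2); move: h; rewrite -EFinD !lte_fin; lra.
    + by exists (r - 1); [rewrite lte_fin; lra|exact: ltry].
    + by exists (a - s + 1); [exact: ltry|rewrite lte_fin; lra].
    + by exists 0; exact: ltry.
  have [V xV Vf] := lf x b fb; have [W xW Wg] := lg x (a - b) gb.
  exists (V `&` W); first exact: filterI.
  move=> y [/Vf bf /Wg abg]; rewrite -(subrKC b a) EFinD.
  exact: lteD.
- apply: epi_econvex.
    by move=> x; exact: adde_gtNy.
  have split x r : epi (fun y => f y + g y)%E x r ->
      exists a b, [/\ epi f x a, epi g x b & r = a + b].
    rewrite /epi; move: (fN x) (gN x); case: (f x) (g x) => [a||] [b||] // _ _.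
    rewrite -EFinD lee_fin => abr; exists (r - b), b.
    by rewrite !lee_fin subrK; split=> //; lra.
  move=> x y r s t /split[a [b [fa gb ->]]] /split[c [d [fc gd ->]]] t01.
  have -> : t * (a + b) + (1 - t) * (c + d) =
            (t * a + (1 - t) * c) + (t * b + (1 - t) * d) by ring.
  by rewrite /epi EFinD; apply: leeD; apply: econvex_epi.
Qed.

End scaling.

Lemma edom_conv (R : realType) (X : normedModType R) (f : X -> \bar R) x y
    (t : R) : econvex f -> 0 < t < 1 -> edom f x -> edom f y ->
  edom f (t *: x + (1 - t) *: y).
Proof.
move=> cf t01; rewrite /edom /= => fx fy; have /andP[t0 t1] := t01.
apply: le_lt_trans (cf x y t t01) _; apply: lte_add_pinfty.
  by rewrite lte_mul_pinfty ?lee_fin// ltW.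
by rewrite lte_mul_pinfty ?lee_fin// subr_ge0 ltW.
Qed.

(** A ball around [x] contained in the domain is carried by the homothety of
    centre [y] to a smaller ball around any other point of the segment. *)
Lemma convex_interior (R : realType) (X : normedModType R) (f : X -> \bar R) :
  econvex f -> convex_set (edom f)°.
Proof.
move=> cf; apply/convex_setW => x y; rewrite !inE => fx fy k k0 k1.
have {fx} /nbhs_distP[r r0 rf] := fx; have {}fy := interior_subset fy.
rewrite inE; apply/nbhs_distP; exists (k%:num * r); first exact: mulr_gt0.
rewrite -[conv _ _ _]/(k%:num *: x + (1 - k%:num) *: y) => z.
set t := k%:num in k0 k1 *; set p := t *: x + _ => zp.
have -> : z = t *: (x + t^-1 *: (z - p)) + (1 - t) *: y.
  rewrite scalerDr scalerA mulfV ?gt_eqF// scale1r addrAC -/p.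
  by rewrite subrKC.
apply: edom_conv => //; first by rewrite k0.
apply: rf; rewrite addrAC subrr add0r normrZ gtr0_norm ?invr_gt0//.
by rewrite ltr_pdivrMl.
Qed.

(** * Criteria for cofiniteness *)

Section cofinite.
Context {R : realType} {X : normedModType R}.
Implicit Types (f g h phi : X -> \bar R) (u v : dual X) (gamma : R).

Lemma cofiniteP h : (forall x, (-oo < h x)%E) ->
  cofinite h <-> forall u, exists M, forall x r, epi h x r -> u x - r <= M.
Proof.
move=> hN; split=> [ch u|hu].
  have hu : edom (conjugate h) u by rewrite [edom _]ch.
  have [cb|cb] := pselect (exists p, edom h p); last first.
    exists 0 => x r xr; exfalso; apply: cb; exists x; exact: le_lt_trans xr (ltry _).
  exists (fine (conjugate h u)); apply/(epi_conjugate _ _ hN).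
  by rewrite /epi -edom_fine//; exact: conjugate_gtNy.
apply/seteqP; split=> // u _; have [M hM] := hu u.
by apply: le_lt_trans (ltry M); apply/(epi_conjugate _ _ hN).
Qed.

(** Affine minorants bound [u - h] on balls, so only its behaviour at infinity
    matters. *)
Lemma cofinite_of_tail h : Gamma0 h ->
  (forall u, exists N M, forall x r, N < `|x| -> epi h x r -> u x - r <= M) ->
  cofinite h.
Proof.
move=> Gh tail; have [hN [p hp] _ _] := Gh; apply/cofiniteP => // u.
have [N' [M hM]] := tail u.
have [|w [c [wh _]]] := @affine_minorant _ _ h p (fine (h p) - 1) Gh.
  by rewrite {2}(edom_fine (hN p) hp) lte_fin; lra.
exists (Order.max M (`|u - w| * N' - c)) => x r xr.
rewrite le_max; have [xN|xN] := ltP N' `|x|; apply/orP; [left|right].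
  exact: hM.
have := wh _ _ xr; have /andP[_] := dual_bound (u - w) x; rewrite dualB.
have : `|u - w| * `|x| <= `|u - w| * N' by rewrite ler_wpM2l.
lra.
Qed.

Lemma supercoercive_cofinite h : Gamma0 h -> supercoercive h -> cofinite h.
Proof.
move=> Gh sh; apply: cofinite_of_tail => // u.
have [N hN] := sh `|u|; exists (Order.max N 0), 0 => x r.
rewrite gt_max => /andP[/hN + x0] xr.
rewrite lte_pdivlMr// -EFinM => /lt_le_trans/(_ xr); rewrite lte_fin.
have /andP[_] := dual_bound u x; lra.
Qed.

Lemma bounded_dom_cofinite h : Gamma0 h -> bounded_set (edom h) -> cofinite h.
Proof.
move=> Gh /pinfty_ex_gt0[N _ hN]; apply: cofinite_of_tail => // u.
exists N, 0 => x r Nx xr; exfalso.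
have := hN x (le_lt_trans xr (ltry _)); rewrite /= leNgt Nx; by [].
Qed.

(** The conjugate of a sum is at most the infimal convolution of the
    conjugates. *)
Lemma cofinite_add_conjugate_doms f phi gamma : 0 < gamma -> Gamma0 f ->
  Gamma0 phi ->
  add_set (edom (conjugate f)) (scale_set gamma (edom (conjugate phi))) = setT ->
  cofinite (fun y => f y + gamma%:E * phi y)%E.
Proof.
move=> g0 Gf Gp fp; have [fN fne _ _] := Gf; have [pN pne _ _] := Gp.
have [gN _ _ _] := Gamma0_scale g0 Gp.
apply/cofiniteP => [x|u]; first exact: adde_gtNy.
have : [set: dual X] u by [].
rewrite -fp => -[a fa [_ [b pb <-] <-]].
have : epi (conjugate f) a (fine (conjugate f a)).
  by rewrite /epi -edom_fine//; exact: conjugate_gtNy.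
have : epi (conjugate phi) b (fine (conjugate phi b)).
  by rewrite /epi -edom_fine//; exact: conjugate_gtNy.
move=> /(epi_conjugate _ _ pN) pB /(epi_conjugate _ _ fN) fA.
exists (fine (conjugate f a) + gamma * fine (conjugate phi b)) => x r.
rewrite /epi; case fx : (f x) (fN x) => [s||] //; case px : (phi x) (pN x) => [t||] // _ _.
  rewrite -EFinM -EFinD lee_fin dualD dualZ => str.
  have := fA x s; rewrite /epi fx => /(_ (lexx _)).
  have := pB x t; rewrite /epi px => /(_ (lexx _)) /(ler_wpM2l (ltW g0)); lra.
all: by rewrite ?gt0_muley ?lte_fin// ?addey ?addye// leye_eq.
Qed.

End cofinite.

(** * Legendre functions *)

Lemma subdiff_monotone (R : realType) (X : normedModType R) (phi : X -> \bar R)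
    y z v w : Gamma0 phi -> subdiff phi y v -> subdiff phi z w ->
  0 <= (v - w) (y - z).
Proof.
move=> [pN pne _ _] yv zw.
have yE := edom_fine (pN y) (subdiff_edom pne yv).
have zE := edom_fine (pN z) (subdiff_edom pne zw).
have := yv z; have := zw y; rewrite yE zE -!EFinD !lee_fin dualB !dual_sub; lra.
Qed.

Section legendre.
Context {R : realType} {X : completeNormedModType R}.
Variables (f : X -> \bar R).
Hypotheses (Gf : Gamma0 f) (fL : legendre f).

Let sf : single_valued_on_dom (subdiff f). Proof. exact: fL.1.2. Qed.

(** Local boundedness of the subdifferential keeps its domain away from the
    boundary of [edom f]. *)
Lemma legendre_nabla z u : nabla f z u <-> subdiff f z u.
Proof.
split=> [/(nabla_subdiff Gf sf)[]//|zu]; apply/(nabla_subdiff Gf sf); split=> //.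
by apply: (interior_of_locally_bounded_subdiff Gf fL.1.1); exists u.
Qed.

(** Evaluation at [z] is a subgradient of [conjugate f] at [u], and the
    subdifferential of [conjugate f] is locally bounded as well. *)
Lemma legendre_nabla_interior_conjugate z u :
  nabla f z u -> (edom (conjugate f))° u.
Proof.
move=> /legendre_nabla zu; have [fN fne _ _] := Gf.
have [xi xiE] := dual_eval z.
have [cu su] := subdiff_conjugate fN fne xiE zu.
have Gc : Gamma0 (conjugate f).
  by apply: Gamma0_conjugate => //; exists u.
apply: (@interior_of_locally_bounded_subdiff R (dual X) _ u Gc fL.2.1).
by exists xi.
Qed.

(** The subgradient inequalities of [z1] and [z2] at their midpoint,
    compared with strict convexity there. *)
Lemma legendre_strictly_monotone z1 z2 u1 u2 :
  nabla f z1 u1 -> nabla f z2 u2 -> (u1 - u2) (z1 - z2) <= 0 -> z1 = z2.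
Proof.
move=> n1 n2; apply: contraPeq => z12; apply/negP; rewrite -ltNge.
have [fN fne _ cf] := Gf.
have [i1 _] := n1; have [i2 _] := n2.
have /(nabla_subdiff Gf sf)[_ s1] := n1.
have /(nabla_subdiff Gf sf)[_ s2] := n2.
have sc : strictly_convex_on (edom f)° f.
  apply: fL.2.2; first exact: convex_interior.
  by move=> z /(nabla_interior Gf sf)[u /legendre_nabla zu]; exists u.
have h2 : 0 < (2^-1 : R) < 1 by lra.
have := sc z1 z2 2^-1 i1 i2 (elimN eqP z12) h2.
set m := _ + _ => fm.
have E1 := edom_fine (fN z1) (interior_subset i1).
have E2 := edom_fine (fN z2) (interior_subset i2).
have Em : f m = (fine (f m))%:E.
  apply: edom_fine => //; apply: edom_conv => //; exact: interior_subset.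
move: fm; rewrite Em E1 E2 -!EFinM -EFinD lte_fin => fm.
have := (subdiff_epiP _ fN E1).1 s1 m (fine (f m)); rewrite /epi -Em => /(_ (lexx _)).
have := (subdiff_epiP _ fN E2).1 s2 m (fine (f m)); rewrite /epi -Em => /(_ (lexx _)).
rewrite !dualB /m !dual_sub !dual_add !dual_scale; lra.
Qed.

(** The sum rule is available because the Legendre function is bounded above
    near every interior point of its domain. *)
Lemma subdiff_add_legendre phi gamma z v : 0 < gamma -> Gamma0 phi ->
  (edom f)° `&` dom_op (subdiff phi) !=set0 ->
  subdiff (fun y => f y + gamma%:E * phi y)%E z v ->
  exists w b, [/\ nabla f z w, subdiff phi z b & v = w + gamma *: b].
Proof.
move=> g0 Gp [p [fp [q pq]]] zv; have [fN _ _ cf] := Gf.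
have Gg := Gamma0_scale g0 Gp; have [gN _ _ cg] := Gg.
have [C [e [e0 fC]]] := Gamma0_bounded_above Gf fp.
have gp : edom (fun y => gamma%:E * phi y)%E p.
  have [pN pne _ _] := Gp; have := subdiff_edom pne pq; rewrite /edom /= => pp.
  by rewrite lte_mul_pinfty// lee_fin ltW.
have [w fw /(subdiff_scale _ _ g0 Gp) gw] := subdiff_add fN gN cf cg e0 fC gp zv.
exists w, (gamma^-1 *: (v - w)); split=> //; first exact/legendre_nabla.
by rewrite scalerA mulfV ?gt_eqF// scale1r subrKC.
Qed.

End legendre.

(** * The warped proximity operator *)

Section existence.
Context {R : realType} {X : completeNormedModType R}.
Variables (phi f : X -> \bar R) (gamma : R).
Hypotheses (Xrefl : reflexive_space X) (Gp : Gamma0 phi) (Gf : Gamma0 f).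
Hypotheses (fL : legendre f) (g0 : 0 < gamma).
Hypothesis domI : (edom f)° `&` dom_op (subdiff phi) !=set0.

Let h y := (f y + gamma%:E * phi y)%E.

Let doms : edom f `&` edom (fun y => gamma%:E * phi y)%E !=set0.
Proof.
have [p [fp [q pq]]] := domI; exists p; split; first exact: interior_subset.
have [pN pne _ _] := Gp; have := subdiff_edom pne pq; rewrite /edom /= => pp.
by rewrite lte_mul_pinfty// lee_fin ltW.
Qed.

Lemma cofinite_of_qualification :
  add_set (edom (conjugate f))°
    (scale_set gamma (dom_op (subdiff (conjugate phi)))) = setT
  \/ cofinite h \/ supercoercive h \/ bounded_set (edom f `&` edom phi) ->
  cofinite h.
Proof.
have Gh : Gamma0 h by apply: Gamma0_add => //; exact: Gamma0_scale.
move=> [fp|[//|[|bd]]]; last 2 first.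
- exact: supercoercive_cofinite.
- apply: bounded_dom_cofinite => //.
  have [M [Mr bM]] := bd; exists M; split=> // K MK y hy.
  apply: (bM K MK).
  have [fN _ _ _] := Gf; have [pN _ _ _] := Gp.
  suff : (f y < +oo)%E /\ (phi y < +oo)%E by [].
  move: hy (fN y) (pN y); rewrite /edom /h /=.
  case: (f y) (phi y) => [s||] [t||] //.
  - by rewrite gt0_muley ?lte_fin// addey.
  - by rewrite gt0_muley ?lte_fin// addey.
apply: cofinite_add_conjugate_doms => //; apply/seteqP; split=> // v _.
have : [set: dual X] v by [].
rewrite -fp => -[a fa [_ [b pb <-] <-]].
exists a; first exact: interior_subset.
exists (gamma *: b) => //; exists b => //; have [xi pxi] := pb.
by apply: subdiff_edom pxi; exact: edom_conjugate_nonempty.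
Qed.

Lemma cofinite_nabla_add_subdiff_surj v : cofinite h ->
  exists z w b, [/\ nabla f z w, subdiff phi z b & v = w + gamma *: b].
Proof.
move=> ch; have Gh : Gamma0 h by apply: Gamma0_add => //; exact: Gamma0_scale.
have [z zv] : exists z, subdiff h z v.
  apply: subdiff_surj_interior_conjugate => //; rewrite [edom _]ch.
  by rewrite interiorT.
by exists z; apply: (subdiff_add_legendre Gf fL g0 Gp domI).
Qed.

End existence.

Unset Implicit Arguments.
Local Open Scope ereal_scope.

Theorem proposition6p6 (R : realType) (X : completeNormedModType R)
    (Xneq0 : exists x : X, x != 0%R) (Xrefl : reflexive_space X)
    (phi f : X -> \bar R) (x : X) (u : dual X) (gamma : R)
    (phiG0 : Gamma0 phi) (fG0 : Gamma0 f) (fL : legendre f)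
    (xf : (edom f)° x) (gamma0 : (0 < gamma)%R)
    (domI : (edom f)° `&` dom_op (subdiff phi) !=set0)
    (hyp :
      add_set [set (gamma *: u)%R] (edom (conjugate f))° `<=`
        ran_op (add_op (nabla f) (scale_op gamma (subdiff phi)))
      \/ add_set (edom (conjugate f))°
           (scale_set gamma (dom_op (subdiff (conjugate phi)))) = setT
      \/ cofinite (fun y => f y + gamma%:E * phi y)
      \/ supercoercive (fun y => f y + gamma%:E * phi y)
      \/ bounded_set (edom f `&` edom phi)) :
  exists z : X,
    warped_prox (nabla f) (fun y => gamma%:E * (phi y - (u y)%:E)) x = [set z] /\
    (bregman f x z + bregman f z x) * (gamma^-1)%:E <= fenchel_young phi x u.
Proof.
have sf : single_valued_on_dom (subdiff f) := fL.1.2.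
have [k xk] := nabla_interior fG0 sf xf.
have [z [w [b [zw zb kE]]]] : exists z w b,
    [/\ nabla f z w, subdiff phi z b & (k + gamma *: u = w + gamma *: b)%R].
  case: hyp => [surj|/(cofinite_of_qualification phiG0 fG0 gamma0 domI) ch].
    have [|z _ [w zw [_ [b zb <-] wb]]] := surj (k + gamma *: u)%R.
      exists (gamma *: u)%R => //; exists k; last by rewrite addrC.
      exact: (legendre_nabla_interior_conjugate fG0 fL xk).
    by exists z, w, b.
  exact: (cofinite_nabla_add_subdiff_surj Xrefl phiG0 fG0 fL gamma0 domI).
(* The subgradient [b] in the form that [subdiff_scale_tilt] asks for. *)
have bE : (gamma^-1 *: (k - w) + u = b)%R.
  have -> : (k - w = gamma *: (b - u))%R.
    rewrite -(addrK (gamma *: u)%R k) kE scalerBr.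
    by rewrite addrAC (addrC w) addrK.
  by rewrite scalerA mulVf ?gt_eqF// scale1r subrK.
exists z; split.
  apply/seteqP; split=> [z' [k' xk' [w' z'w' [v' /= z'v' kE']]]|_ ->].
    have kk' : k' = k.
      have /(nabla_subdiff fG0 sf)[_ s1] := xk.
      have /(nabla_subdiff fG0 sf)[_ s2] := xk'.
      exact: sf s2 s1.
    apply: (legendre_strictly_monotone fG0 fL z'w' zw).
    move: z'v' => /(subdiff_scale_tilt _ _ _ gamma0 phiG0) z'b'.
    have := subdiff_monotone phiG0 z'b' zb.
    have v'E : v' = (k - w')%R by rewrite -kk' -kE' addrC addKr.
    rewrite -bE v'E opprD addrACA subrr addr0 -scalerBr dualZ.
    rewrite pmulr_rge0 ?invr_gt0// !dualB; lra.
  exists k => //; exists w => //; exists (k - w)%R; last by rewrite subrKC.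
  by apply/(subdiff_scale_tilt _ _ _ gamma0 phiG0); rewrite bE.
rewrite (bregman_nabla fG0 sf x zw) (bregman_nabla fG0 sf z xk).
have /(nabla_subdiff fG0 sf)[/interior_subset zf _] := zw.
have [fN _ _ _] := fG0; have [pN pne _ _] := phiG0.
rewrite (edom_fine (fN z) zf) (edom_fine (fN x) (interior_subset xf)).
have pz := edom_fine (pN z) (subdiff_edom pne zb).
have px : (b (x - z))%:E + phi z <= phi x := zb x.
have cz := conjugate_ge phi u z.
rewrite -!EFinB -EFinD -EFinM /fenchel_young.
move: px cz; rewrite pz -EFinD -EFinB => px cz.
apply: le_trans (leeB (leeD px cz) (lexx _)).
rewrite -!EFinD lee_fin -bE dualD dualZ dualB !dual_sub.
rewrite le_eqVlt; apply/orP; left; apply/eqP; field; exact: lt0r_neq0.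
Qed.
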